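(* Let $q$ be a prime power and $n\ge 2$. The parameters $[N,K,d_{\min}]$ (length, dimension, minimum distance) of the line orthogonal Grassmann code associated with a non-degenerate quadratic form on a vector space of dimension $2n+1$ over $\mathbb{F}_q$ are $$N=\frac{(q^{2n}-1)(q^{2n-2}-1)}{(q-1)(q^2-1)},\qquad K=\begin{cases}(2n+1)n & \text{if } q \text{ is odd},\\ (2n+1)n-1 & \text{if } q \text{ is even},\end{cases}\qquad d_{\min}=q^{4n-5}-q^{3n-4}.$$
   Context: Let $V$ be a vector space of dimension $2n+1$ over $\mathbb{F}_q$ and $\eta:V\to\mathbb{F}_q$ a non-degenerate quadratic form. Let $\Delta_2$ be the set of all $2$-dimensional subspaces of $V$ that are totally singular for $\eta$. Let $\varepsilon_2$ be the Plücker embedding $\langle v_1,v_2\rangle\mapsto\langle v_1\wedge v_2\rangle\in \mathrm{PG}(\bigwedge^2V)$, and let $\varepsilon_2(\Delta_2)=\{\omega_1,\dots,\omega_N\}$, where for each point a vector representative $\omega_i=v_1\wedge v_2$ is fixed. The line orthogonal Grassmann code is the linear code consisting of all words $(\varphi(\omega_1),\dots,\varphi(\omega_N))$ as $\varphi$ ranges over the linear functionals on $\bigwedge^2 V$ (equivalently, alternating bilinear forms on $V$); it is well defined up to monomial equivalence. *)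

(* Defs.v *)
From HB Require Import structures.
From mathcomp Require Import all_boot all_order all_algebra all_field.

Set Implicit Arguments.
Unset Strict Implicit.
Unset Printing Implicit Defensive.

Import Order.TTheory GRing.Theory Num.Theory.
Local Open Scope ring_scope.

HB.instance Definition _ (F : finFieldType) (V : vectType F) :=
  isCountable.Build {vspace V}
    (pcan_pickleK (can_pcan (@VectorInternalTheory.vs2mxK F V))).
HB.instance Definition _ (F : finFieldType) (V : vectType F) :=
  isFinite.Build {vspace V}
    (pcan_enumP (can_pcan (@VectorInternalTheory.vs2mxK F V))).

Section QuadraticForms.
Variables (F : finFieldType) (V : vectType F).
Implicit Types (eta : V -> F) (U : {vspace V}).

Definition polar eta (u v : V) : F := eta (u + v) - eta u - eta v.

Definition is_quadratic_form eta : Prop :=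
  [/\ forall a v, eta (a *: v) = a ^+ 2 * eta v,
      forall u, scalar (polar eta u)
    & forall v, scalar (polar eta ^~ v)].

(* The radical of [eta] (singular vectors of the radical of the polar form) is
   trivial.  In odd characteristic this says that the polar form is
   non-degenerate; in characteristic 2 and odd dimension the alternating polar
   form always has a nonzero radical, on which [eta] must be anisotropic. *)
Definition nondegenerate_quadratic_form eta : Prop :=
  forall v, eta v = 0 -> (forall w, polar eta v w = 0) -> v = 0.

(* [finvect_type V] is [V] with its finType structure. *)
Definition totally_singular eta U : bool :=
  [forall v : finvect_type V, (v \in U) ==> (eta v == 0)].

Lemma totally_singularP eta U :
  reflect (forall v, v \in U -> eta v = 0) (totally_singular eta U).
Proof.
apply: (iffP forallP) => h v; first by move=> vU; apply/eqP/(implyP (h v)).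
by apply/implyP=> vU; apply/eqP/h.
Qed.

Definition singular_lines eta : {set {vspace V}} :=
  [set U | (\dim U == 2%N) && totally_singular eta U].

End QuadraticForms.

(* The exterior square in Pluecker coordinates with respect to the basis
   [vbasis {:V}]; [wedge_universal] is its universal property. *)
Section ExteriorSquare.
Variables (F : fieldType) (V : vectType F).

Definition ext2_index : predArgType :=
  {p : 'I_(\dim {:V}) * 'I_(\dim {:V}) | (p.1 < p.2)%N}.

Definition ext2 := {ffun ext2_index -> F^o}.

Definition wedge (u v : V) : ext2 :=
  let x := coord (vbasis {:V}) in
  [ffun p => x (val p).1 u * x (val p).2 v - x (val p).2 u * x (val p).1 v].

Definition pluecker (U : {vspace V}) : {vspace ext2} :=
  <[wedge (vbasis U)`_0 (vbasis U)`_1]>%VS.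

Lemma wedgeDl u u' v : wedge (u + u') v = wedge u v + wedge u' v.
Proof. by apply/ffunP=> p; rewrite !ffunE !linearD /= !mulrDl opprD addrACA. Qed.

Lemma wedgeZl a u v : wedge (a *: u) v = a *: wedge u v.
Proof.
by apply/ffunP=> p; rewrite !ffunE !linearZ /= /GRing.scale /= mulrBr !mulrA.
Qed.

Lemma wedgevv v : wedge v v = 0.
Proof. by apply/ffunP=> p; rewrite !ffunE mulrC subrr. Qed.

Lemma wedgeC u v : wedge u v = - wedge v u.
Proof.
apply/ffunP=> p; rewrite !ffunE opprB.
by congr (_ - _); rewrite mulrC.
Qed.

Lemma wedgeDr u v v' : wedge u (v + v') = wedge u v + wedge u v'.
Proof. by rewrite wedgeC wedgeDl opprD -!(wedgeC u). Qed.

Lemma wedgeZr a u v : wedge u (a *: v) = a *: wedge u v.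
Proof. by rewrite wedgeC wedgeZl -scalerN -wedgeC. Qed.

Lemma sum_alternating (W : lmodType F) n (g : 'I_n -> 'I_n -> W) :
    (forall i, g i i = 0) ->
  \sum_i \sum_j g i j =
  \sum_(p : {p : 'I_n * 'I_n | (p.1 < p.2)%N})
     (g (val p).1 (val p).2 + g (val p).2 (val p).1).
Proof.
move=> g0; rewrite pair_big /=.
rewrite (bigID (fun p : 'I_n * 'I_n => (p.1 < p.2)%N)) /=.
rewrite [X in _ + X](bigID (fun p : 'I_n * 'I_n => (p.2 < p.1)%N)) /=.
rewrite [X in _ + (_ + X)]big1 ?addr0; last first.
  move=> [i j] /=; rewrite -!leqNgt -eqn_leq => /eqP/val_inj ->; exact: g0.
have -> : \sum_(p : 'I_n * 'I_n | ~~ (p.1 < p.2)%N && (p.2 < p.1)%N) g p.1 p.2 =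
          \sum_(p : 'I_n * 'I_n | (p.1 < p.2)%N) g p.2 p.1.
  rewrite (reindex_inj (inv_inj (@swap_pairK _ _))) /=.
  by apply: eq_bigl => -[i j] /=; case: ltngtP.
rewrite -big_split /=.
rewrite (reindex_omap (val : {p : 'I_n * 'I_n | (p.1 < p.2)%N} -> _) insub) /=.
  by apply: eq_bigl => -[p ltp] /=; rewrite ltp insubT /= eqxx.
by move=> p ltp; rewrite insubT.
Qed.

Lemma wedge_span2 x y u v :
  u \in <<[:: x; y]>>%VS -> v \in <<[:: x; y]>>%VS ->
  wedge u v \in <[wedge x y]>%VS.
Proof.
have span2 w : w \in <<[:: x; y]>>%VS -> exists a b, w = a *: x + b *: y.
  rewrite span_cons span_seq1 => /memv_addP[_ /vlineP[a ->] [_ /vlineP[b ->] ->]].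
  by exists a, b.
move=> /span2[a [b ->]] /span2[c [d ->]]; apply/vlineP; exists (a * d - b * c).
rewrite wedgeDl !wedgeDr !wedgeZl !wedgeZr !wedgevv !scaler0 add0r addr0.
by rewrite (wedgeC y x) !scalerN !scalerA scalerBl.
Qed.

Lemma pluecker_span (U : {vspace V}) u v :
  \dim U = 2%N -> <<[:: u; v]>>%VS = U -> pluecker U = <[wedge u v]>%VS.
Proof.
move=> dU Uuv.
have Ub : <<[:: (vbasis U)`_0; (vbasis U)`_1]>>%VS = U.
  rewrite -[RHS](span_basis (vbasisP U)); congr span.
  have: size (vbasis U) = 2%N by rewrite size_tuple.
  by case: (tval (vbasis U)) => [|x [|y []]].
have mem_pair (x y : V) : <<[:: x; y]>>%VS = U -> x \in U /\ y \in U.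
  by move=> <-; rewrite !memv_span ?inE ?eqxx ?orbT.
have [b0 b1] := mem_pair _ _ Ub; have [mu mv] := mem_pair _ _ Uuv.
rewrite /pluecker; apply/eqP; rewrite eqEsubv -!memvE.
by apply/andP; split; apply: wedge_span2; rewrite ?Ub ?Uuv.
Qed.

Lemma linear_comb (U W : lmodType F) (I : finType) (f : U -> W) (a : I -> F)
    (x : I -> U) :
  linear f -> f (\sum_i a i *: x i) = \sum_i a i *: f (x i).
Proof.
move=> fL; pose g : {linear U -> W} :=
  HB.pack f (GRing.isLinear.Build F U W _ f fL).
rewrite -[f]/(g : U -> W) linear_sum.
by apply: eq_bigr => i _; rewrite linearZ.
Qed.

Lemma wedge_universal (W : vectType F) (b : V -> V -> W) :
    (forall u, linear (b u)) -> (forall v, linear (b ^~ v)) ->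
    (forall v, b v v = 0) ->
  exists! f : 'Hom(ext2, W), forall u v, f (wedge u v) = b u v.
Proof.
move=> br bl b0.
pose e i := (vbasis {:V})`_(i : 'I_(\dim {:V})).
have sum_e (v : V) : v = \sum_i coord (vbasis {:V}) i v *: e i.
  exact: coord_vbasis (memvf v).
have bE u v : b u v = \sum_i \sum_j (coord (vbasis {:V}) i u *
    coord (vbasis {:V}) j v) *: b (e i) (e j).
  rewrite [in LHS](sum_e u) (linear_comb _ _ (bl v)); apply: eq_bigr => i _.
  rewrite [in LHS](sum_e v) (linear_comb _ _ (br (e i))) scaler_sumr.
  by apply: eq_bigr => j _; rewrite scalerA.
have bN u v : b v u = - b u v.
  apply/eqP; rewrite -addr_eq0; apply/eqP; have := b0 (u + v).
  have := br (u + v) 1 u v; rewrite !scale1r => ->.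
  have := bl u 1 u v; rewrite !scale1r => ->.
  have := bl v 1 u v; rewrite !scale1r => ->.
  by rewrite !b0 add0r addr0.
have free_b : free (vbasis {:V}) := basis_free (vbasisP _).
pose f0 (z : ext2) : W := \sum_p z p *: b (e (val p).1) (e (val p).2).
have f0_lin : linear f0.
  move=> a y z; rewrite /f0 scaler_sumr -big_split; apply: eq_bigr => p _ /=.
  by rewrite !ffunE scalerDl scalerA.
pose f1 : {linear ext2 -> W} := HB.pack f0 (GRing.isLinear.Build F ext2 W _ f0 f0_lin).
have f1E z : linfun f1 z = f0 z by rewrite lfunE.
exists (linfun f1); split=> [u v|f fE].
  rewrite f1E bE sum_alternating => [|i]; last by rewrite b0 scaler0.
  apply: eq_bigr => p _; rewrite ffunE [in RHS](bN (e (val p).1)).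
  by rewrite scalerN -scalerBl.
have wedge_e (p : ext2_index) : wedge (e (val p).1) (e (val p).2) =
    [ffun p' => (p' == p)%:R].
  apply/ffunP=> p'; rewrite !ffunE !coord_free //.
  case: p p' => [[i j] /= ij] [[k l] /= kl].
  rewrite -[_ == exist _ (i, j) ij]val_eqE /= xpair_eqE.
  rewrite -!natrM !mulnb (eq_sym k) (eq_sym l).
  have -> : (i == l) && (j == k) = false.
    by apply/negP=> /andP[/eqP il /eqP jk]; move: kl; rewrite -jk -il ltnNge ltnW.
  by rewrite subr0.
apply/lfunP=> z.
have -> : z = \sum_p (z p : F) *: wedge (e (val p).1) (e (val p).2).
  apply/ffunP=> p; rewrite sum_ffunE (bigD1 p) //= big1 => [|p' pp'].
    by rewrite wedge_e !ffunE eqxx addr0 /GRing.scale /= mulr1.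
  by rewrite wedge_e !ffunE eq_sym (negPf pp') scaler0.
rewrite !linear_sum; apply: eq_bigr => p _; rewrite !linearZ /=; congr (_ *: _).
rewrite fE f1E /f0 (bigD1 p) //= wedge_e !ffunE eqxx scale1r big1 ?addr0 //.
by move=> p' pp'; rewrite !ffunE (negPf pp') scale0r.
Qed.
End ExteriorSquare.

Section Codes.
Variables (F : finFieldType) (N : nat).
Implicit Types (x y : 'rV[F]_N) (C : {vspace 'rV[F]_N}).

Definition hamming_dist x y : nat := #|[set i | x 0 i != y 0 i]|.

Definition is_min_dist C (d : nat) : Prop :=
  (exists x y, [/\ x \in C, y \in C, x != y & hamming_dist x y = d]) /\
  (forall x y, x \in C -> y \in C -> x != y -> (d <= hamming_dist x y)%N).

End Codes.

Section LineGrassmannCode.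
Variables (F : finFieldType) (V : vectType F).

Definition pluecker_points (eta : V -> F) : {set {vspace ext2 V}} :=
  [set pluecker U | U in singular_lines eta].

(* [omega] lists the points of [pluecker_points eta] without repetition, each
   through a representative of the form [wedge v1 v2]. *)
Definition point_representatives (eta : V -> F) N (omega : 'I_N -> ext2 V) :
    Prop :=
  [/\ injective (fun i => <[omega i]>%VS),
      [set <[omega i]>%VS | i : 'I_N] = pluecker_points eta
    & forall i, exists v1 v2, omega i = wedge v1 v2].

Definition word N (omega : 'I_N -> ext2 V) (phi : 'Hom(ext2 V, F^o)) : 'rV[F]_N :=
  \row_i phi (omega i).

Fact word_is_linear N (omega : 'I_N -> ext2 V) : linear (word omega).
Proof.
by move=> a f g; apply/rowP=> i; rewrite !mxE add_lfunE scale_lfunE.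
Qed.
HB.instance Definition _ N (omega : 'I_N -> ext2 V) :=
  GRing.isLinear.Build F 'Hom(ext2 V, F^o) 'rV[F]_N _ (word omega)
    (word_is_linear omega).

Definition grassmann_code N (omega : 'I_N -> ext2 V) : {vspace 'rV[F]_N} :=
  limg (linfun (word omega)).

Lemma grassmann_codeP N (omega : 'I_N -> ext2 V) (c : 'rV[F]_N) :
  reflect (exists phi, c = word omega phi) (c \in grassmann_code omega).
Proof.
apply: (iffP memv_imgP) => [[phi _ ->]|[phi ->]]; exists phi;
  by rewrite ?lfunE ?memvf.
Qed.

Lemma point_representatives_exist (eta : V -> F) :
  exists omega : 'I_#|pluecker_points eta| -> ext2 V,
    point_representatives eta omega.
Proof.
have exU (i : 'I_#|pluecker_points eta|) : exists U, enum_val i == pluecker U.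
  by have /imsetP[U _ ->] := enum_valP i; exists U.
pose b i j : V := (vbasis (xchoose (exU i)))`_j.
exists (fun i => wedge (b i 0%N) (b i 1%N)).
have E i : <[wedge (b i 0%N) (b i 1%N)]>%VS = enum_val i.
  by rewrite (eqP (xchooseP (exU i))).
split.
- by move=> i j /=; rewrite !E => /enum_val_inj.
- apply/setP=> P; apply/imsetP/idP => [[i _ ->]|PP].
    by rewrite E enum_valP.
  by exists (enum_rank_in PP P) => //; rewrite E enum_rankK_in.
- by move=> i; exists (b i 0%N), (b i 1%N).
Qed.

End LineGrassmannCode.

(* Main.v *)
(* Let B be the polar form of eta, let dim V = 2m+3 and t = q^m.  A word of the
   code is given by an alternating form beta, and its weight is the number of
   singular lines on which beta does not vanish; (q^2 - 1)(q^2 - q) times this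
   weight is the number of pairs (u, v) with eta u = eta v = B u v = 0 and
   beta u v <> 0.  For fixed u these v are the singular vectors of u^perp outside
   U_u = u^perp :&: ker (beta u).  Unless u is an "eigenvector"
   (beta u = l * B u for some scalar l, where U_u = u^perp), U_u has codimension
   2 in V and at most t^2 + qt - t singular vectors, and at most t^2 if U_u is a
   degenerate section.  Summing over u, the weight is at least
   q^(4m-1) - q^(3m-1) as soon as |S| t + t^2 <= |Y| + t^3, where S is the set of
   singular eigenvectors and Y is S together with the u whose section is
   degenerate.  This inequality is proved by bounding S through the eigenspaces
   of the pencil beta - l * B, which are pairwise orthogonal for B unless
   l + l' = 0, and whose dimension is odd when beta - l * B is alternating.  The
   bound is attained by B(f, -) /\ g for a singular f and a suitable functional
   g.  Since the only forms vanishing on all singular lines are the multiples of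
   B that are alternating (0 if q is odd, all of them if q is even), the
   dimension follows. *)

Require Import Defs.
From mathcomp Require Import all_boot all_order all_algebra all_field.
From mathcomp Require Import zify ring.

Set Implicit Arguments.
Unset Strict Implicit.
Unset Printing Implicit Defensive.

Import GRing.Theory.
Local Open Scope ring_scope.

(** * Counting in finite vector spaces *)

Lemma card_fibers (T S : finType) (A : {set T}) (g : T -> S) :
  #|A| = (\sum_s #|[set x in A | g x == s]|)%N.
Proof.
rewrite -sum1_card (partition_big g xpredT) //=; apply: eq_bigr => s _.
by rewrite -sum1_card; apply: eq_bigl => x; rewrite inE.
Qed.

Lemma card_pairs (T S : finType) (A : pred T) (P : T -> pred S) :
  #|[set p : T * S | A p.1 && P p.1 p.2]| =
  (\sum_(x | A x) #|[set y | P x y]|)%N.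
Proof.
rewrite -sum1_card; under eq_bigl do rewrite inE.
rewrite -(pair_big_dep A P (fun _ _ => 1%N)) /=; apply: eq_bigr => x _.
by rewrite -sum1_card; apply: eq_bigl => y; rewrite inE.
Qed.

Lemma card_pairs_swap (T S : finType) (P : T -> S -> bool) :
  (\sum_x #|[set y | P x y]| = \sum_y #|[set x | P x y]|)%N.
Proof.
under eq_bigr do rewrite -sum1dep_card big_mkcond.
under [RHS]eq_bigr do rewrite -sum1dep_card big_mkcond.
exact: exchange_big.
Qed.

Lemma card_bigcup_le (T I : finType) (P : pred I) (D : I -> {set T}) (A : {set T}) :
  (forall v, v \in A -> exists2 i, P i & v \in D i) ->
  (#|A| <= \sum_(i | P i) #|D i|)%N.
Proof.
move=> AD; apply: (@leq_trans #|\bigcup_(i | P i) D i|).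
  by apply: subset_leq_card; apply/subsetP => v /AD[i Pi vD]; apply/bigcupP; exists i.
elim/big_ind2: _ => [|a X b Y' Xa Yb|//]; first by rewrite cards0.
by rewrite (leq_trans (leq_card_setU X Y')) // leq_add.
Qed.

Section FiniteVectorSpaces.
Variables (F : finFieldType) (V0 : vectType F).
Local Notation V := (finvect_type V0).
Local Notation q := #|F|.
Implicit Types (U W : {vspace V}) (u v x : V) (f : V -> F) (b : V -> V -> F).

Lemma q_gt1 : (1 < q)%N. Proof. exact: finNzRing_gt1. Qed.
Lemma q_gt0 : (0 < q)%N. Proof. exact: ltnW q_gt1. Qed.

Lemma card_vs U : #|[set v in U]| = (q ^ \dim U)%N.
Proof. by rewrite -card_vspace; apply: eq_card => v; rewrite inE. Qed.

(** A subspace cut out by a predicate is encoded as the span of the vectors satisfying it. For a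
    predicate stable under linear combinations the span adds nothing, which is [mem_solutions]. *)
Definition solutions (P : pred V) : {vspace V} := <<enum P>>%VS.

Lemma mem_solutions (P : pred V) :
    P 0 -> (forall a u v, P u -> P v -> P (a *: u + v)) ->
  forall v, (v \in solutions P) = P v.
Proof.
move=> P0 PL v; apply/idP/idP; last first.
  by move=> Pv; rewrite memv_span // mem_enum.
rewrite /solutions span_def big_tnth => /memv_sumP[g gP ->].
elim/big_rec: _ => // i x _ Px.
have /vlineP[k ->] := gP i isT; apply: PL => //.
by have := mem_tnth i (in_tuple (enum P)); rewrite mem_enum.
Qed.

Lemma linZ f a u : scalar f -> f (a *: u) = a * f u.
Proof.
move=> fL; have f0 : f 0 = 0.
  by have := fL (-1) 0 0; rewrite scaler0 addr0 mulN1r addNr.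
by have := fL a u 0; rewrite !addr0 f0 addr0.
Qed.

Lemma lin0 f : scalar f -> f 0 = 0.
Proof. by move=> fL; rewrite -(scale0r 0) linZ // mul0r. Qed.

Lemma linD f u v : scalar f -> f (u + v) = f u + f v.
Proof. by move=> fL; rewrite -{1}(scale1r u) fL mul1r. Qed.

Lemma linN f u : scalar f -> f (- u) = - f u.
Proof. by move=> fL; rewrite -scaleN1r linZ // mulN1r. Qed.

Lemma linB f u v : scalar f -> f (u - v) = f u - f v.
Proof. by move=> fL; rewrite linD // linN. Qed.

Definition kerf f : {vspace V} := solutions [pred v | f v == 0].

Lemma mem_kerf f v : scalar f -> (v \in kerf f) = (f v == 0).
Proof.
move=> fL; rewrite mem_solutions //= ?lin0 // => a u w /eqP fu /eqP fw.
by rewrite fL fu fw mulr0 addr0.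
Qed.

(** Translation by the multiple of [v0] on which [f] takes the value [c] maps the zero fibre onto
    the fibre over [c]. *)
Lemma card_fiber f U v0 c : scalar f -> v0 \in U -> f v0 != 0 ->
  #|[set v in U | f v == c]| = #|[set v in U | f v == 0]|.
Proof.
move=> fL v0U f0; pose v1 := (c / f v0) *: v0.
have fv1 : f v1 = c by rewrite linZ // mulfVK.
have v1U : v1 \in U by rewrite memvZ.
rewrite -(card_imset [set v in U | f v == 0] (addIr v1)).
apply: eq_card => v; rewrite inE; apply/andP/imsetP => [[vU /eqP fv]|[w + ->]].
  exists (v - v1); last by rewrite subrK.
  by rewrite inE memvB //= linB // fv fv1 subrr.
by rewrite inE => /andP[wU /eqP fw]; rewrite memvD // linD // fw fv1 add0r.
Qed.

Lemma card_fiber_mul f U v0 c : scalar f -> v0 \in U -> f v0 != 0 ->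
  (q * #|[set v in U | f v == c]|)%N = (q ^ \dim U)%N.
Proof.
move=> fL v0U f0; rewrite -card_vs [RHS](card_fibers _ f).
rewrite (eq_bigr (fun=> #|[set v in U | f v == c]|)) ?sum_nat_const // => c' _.
rewrite !(card_fiber _ fL v0U) // -(card_fiber c' fL v0U f0).
by apply: eq_card => v; rewrite !inE.
Qed.

(** Dimensions are compared through cardinalities: each of the [q] fibres of [f] on [U] is as large
    as the kernel. *)
Lemma dim_kerf f U v0 : scalar f -> v0 \in U -> f v0 != 0 ->
  (\dim (U :&: kerf f)).+1 = \dim U.
Proof.
move=> fL v0U f0; apply: (@expnI q); rewrite ?q_gt1 // expnS.
rewrite -(card_fiber_mul 0 fL v0U f0) -card_vs; congr (_ * _)%N.
by apply: eq_card => v; rewrite !inE memv_cap mem_kerf.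
Qed.

Lemma dim_kerf_ge f U : scalar f -> (\dim U <= (\dim (U :&: kerf f)).+1)%N.
Proof.
move=> fL; have [/subvP sUk|/subvPn[v0 v0U]] := boolP (U <= kerf f)%VS.
  by rewrite leqW // dimvS // subv_cap subvv; apply/subvP.
by rewrite mem_kerf // => f0; rewrite (dim_kerf fL v0U f0).
Qed.

Lemma proportional f g : scalar f -> scalar g ->
  (forall v, f v = 0 -> g v = 0) -> exists l, forall v, g v = l * f v.
Proof.
move=> fL gL fg; have [/existsP[v0 f0]|/existsPn fE] := boolP [exists v : V, f v != 0].
  exists (g v0 / f v0) => v.
  have /fg: f (v - (f v / f v0) *: v0) = 0 by rewrite linB // linZ // mulfVK ?subrr.
  by rewrite linB // linZ // => /subr0_eq->; ring.
by exists 0 => v; rewrite mul0r; apply: fg; apply/eqP/negPn/fE.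
Qed.

Definition bilin b : Prop := (forall u, scalar (b u)) /\ (forall v, scalar (b ^~ v)).

Lemma bilDr b u v w : bilin b -> b u (v + w) = b u v + b u w.
Proof. by move=> [bl _]; exact: (linD _ _ (bl u)). Qed.

Lemma bilDl b u v w : bilin b -> b (u + v) w = b u w + b v w.
Proof. by move=> [_ br]; exact: (linD _ _ (br w)). Qed.

Lemma bilZr b k u v : bilin b -> b u (k *: v) = k * b u v.
Proof. by move=> [bl _]; exact: (linZ _ _ (bl u)). Qed.

Lemma bilZl b k u v : bilin b -> b (k *: u) v = k * b u v.
Proof. by move=> [_ br]; exact: (linZ _ _ (br v)). Qed.

Lemma bil0l b v : bilin b -> b 0 v = 0.
Proof. by move=> bL; rewrite -(scale0r 0) bilZl // mul0r. Qed.

Definition flip b u v := b v u.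

Lemma flip_bilin b : bilin b -> bilin (flip b).
Proof. by case. Qed.

Definition orth b U : {vspace V} :=
  solutions [pred v | [forall u : V, (u \in U) ==> (b u v == 0)]].

Lemma orthP b U v : bilin b ->
  reflect (forall u, u \in U -> b u v = 0) (v \in orth b U).
Proof.
move=> [bl br]; rewrite mem_solutions /=.
- apply: (iffP forallP) => h u; first by move=> uU; exact/eqP/(implyP (h u)).
  by apply/implyP => uU; apply/eqP/h.
- by apply/forallP=> u; rewrite (lin0 (bl u)) eqxx implybT.
move=> a w1 w2 /forallP h1 /forallP h2; apply/forallP=> u; apply/implyP => uU.
rewrite bl (eqP (implyP (h1 u) uU)) (eqP (implyP (h2 u) uU)).
by rewrite mulr0 addr0.
Qed.

(** Pairs with [b u w = 0] are counted by [u]: a vector of [U] orthogonal to all of [W] admits every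
    [w], any other admits a fraction [1/q] of [W]. The identity is arranged so that it contains no
    subtraction. *)
Lemma card_orth_pairs b U W : bilin b ->
  (q * \sum_(u in U) #|[set w in W | b u w == 0%R]| + q ^ \dim (U :&: orth (flip b) W) * q ^ \dim W =
   q ^ \dim U * q ^ \dim W + q * (q ^ \dim (U :&: orth (flip b) W) * q ^ \dim W))%N.
Proof.
move=> bL; have [bl br] := bL; set R := orth _ W.
have -> : (\sum_(u in U) #|[set w in W | b u w == 0%R]| =
  q ^ \dim (U :&: R) * q ^ \dim W +
  \sum_(u in U | u \notin R) #|[set w in W | b u w == 0%R]|)%N.
  rewrite (bigID (fun u => u \in R)) /=; congr (_ + _)%N.
  rewrite (eq_bigr (fun=> (q ^ \dim W)%N)) => [|u /andP[uU uR]].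
    rewrite sum_nat_const -!card_vs; congr (_ * _)%N.
    by apply: eq_card => v; rewrite !inE memv_cap.
  rewrite -card_vs; apply: eq_card => w; rewrite !inE.
  have [wW|//] := boolP (w \in W).
  by move/(orthP W u (flip_bilin bL)): uR => /(_ w wW); rewrite /flip => ->; rewrite eqxx.
have E : (q * \sum_(u in U | u \notin R) #|[set w in W | b u w == 0%R]| =
    #|[set u in U | u \notin R]| * q ^ \dim W)%N.
  rewrite big_distrr /= (eq_bigr (fun=> (q ^ \dim W)%N)) => [|u /andP[uU uR]].
    by rewrite sum_nat_const; congr (_ * _)%N; apply: eq_card => v; rewrite !inE.
  have [w wW bw] : exists2 w, w \in W & b u w != 0.
    have [/exists_inP //|/exists_inPn h] := boolP [exists w in W, b u w != 0].
    case/negP: uR.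
    apply/orthP => [|w wW]; first exact: flip_bilin.
    by apply/eqP; have := h w wW; rewrite negbK.
  by rewrite (card_fiber_mul 0 (bl u) wW bw).
have -> : (q ^ \dim U = q ^ \dim (U :&: R) + #|[set u in U | u \notin R]|)%N.
  rewrite -!card_vs -(cardsID [set v in R]); congr (_ + _)%N; apply: eq_card => v;
    by rewrite !inE ?memv_cap // andbC.
by rewrite mulnDr E; lia.
Qed.

(* Counting the pairs with [b u w = 0] once by [u] and once by [w]. *)
Lemma dim_orth_pairing b U W : bilin b ->
  (\dim U + \dim (W :&: orth b U) = \dim W + \dim (U :&: orth (flip b) W))%N.
Proof.
move=> bL; have := card_orth_pairs U W bL.
have := card_orth_pairs W U (flip_bilin bL).
rewrite -[flip (flip b)]/b.
have -> : (\sum_(u in W) #|[set w in U | flip b u w == 0%R]| =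
          \sum_(u in U) #|[set w in W | b u w == 0%R]|)%N.
  have := card_pairs_swap (fun u w => [&& u \in U, w \in W & b u w == 0]).
  rewrite [X in X = _](bigID (mem U)) /= [X in (_ + X)%N]big1 ?addn0; last first.
    by move=> u /negPf uU; rewrite uU -(cards0 V); apply: eq_card => w; rewrite !inE.
  rewrite [X in _ = X](bigID (mem W)) /= [X in (_ + X)%N]big1 ?addn0; last first.
    by move=> w /negPf wW; rewrite wW -(cards0 V); apply: eq_card => u; rewrite !inE andbF.
  move=> E; transitivity (\sum_(w in W) #|[set u in U | w \in W & b u w == 0%R]|)%N.
    by apply: eq_bigr => w wW; apply: eq_card => u; rewrite !inE wW.
  rewrite -E; apply: eq_bigr => u uU; apply: eq_card => w.
  by rewrite !inE uU.
move: (\sum_(u in U) _)%N => A E1 E2.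
(* The difference of the two counts, divided by [q - 1], is the claim in exponential form. *)
apply: (@expnI q); rewrite ?q_gt1 // !expnD; move: E1 E2; have := q_gt1.
move: (q ^ \dim U)%N (q ^ \dim W)%N (q ^ _)%N (q ^ _)%N => x y z t.
move: q => q0; nia.
Qed.

Lemma dim_add_line U v : v \notin U -> \dim (U + <[v]>) = (\dim U).+1.
Proof.
move=> vT; rewrite dimv_disjoint_sum ?dim_vline.
  by rewrite (contraNneq _ vT) ?addn1 // => ->; rewrite mem0v.
apply/eqP; rewrite -subv0; apply/subvP => w; rewrite memv_cap => /andP[wT /vlineP[x E]].
rewrite memv0 E; have [->|x0] := eqVneq x 0; first by rewrite scale0r.
case/negP: vT; have -> : v = x^-1 *: w by rewrite E scalerA mulVf // scale1r.
by rewrite memvZ.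
Qed.

Lemma exists_nonzero U : (0 < \dim U)%N -> exists2 u, u \in U & u != 0.
Proof.
move=> U0; exists (vpick U); first exact: memv_pick.
by rewrite vpick0 -dimv_eq0 -lt0n.
Qed.

Lemma exists_notin U W : (\dim W < \dim U)%N -> exists2 u, u \in U & u \notin W.
Proof.
by move=> WU; apply/subvPn/negP => /dimvS; rewrite leqNgt WU.
Qed.

(** The vector [h v] is the component of [v] along a complement of [W]. Some coordinate of [h x] is
    nonzero, and dividing by it normalises the functional. *)
Lemma exists_functional W x : x \notin W ->
  exists f : V -> F, [/\ scalar f, f x = 1 & forall w, w \in W -> f w = 0].
Proof.
move=> xW; pose h v := v - projv W v.
have hx : h x != 0.
  by apply: contra xW; rewrite subr_eq0 => /eqP ->; exact: memv_proj.
have [i hi] : exists i, coord (vbasis {:V}) i (h x) != 0.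
  apply/existsP; apply: contraNT hx => /existsPn hc.
  rewrite [h x](coord_vbasis (memvf _)); apply/eqP/big1 => i _.
  by rewrite (eqP (negbNE (hc i))) scale0r.
exists (fun v => coord (vbasis {:V}) i (h v) / coord (vbasis {:V}) i (h x)); split.
- move=> a u v; rewrite /h linearP opprD addrACA -scalerBr linearP /=.
  by rewrite mulrDl mulrA.
- by rewrite divff.
by move=> w wW; rewrite /h projv_id // subrr linear0 mul0r.
Qed.

End FiniteVectorSpaces.

(** * Quadratic forms and the Witt decomposition *)

Section FieldCounting.
Variable F : finFieldType.
Local Notation q := #|F|.

Lemma card_hyperbola (c : F) :
  #|[set p : F * F | p.1 * p.2 == c]| = ((c == 0%R) * q + (q - 1))%N.
Proof.
rewrite -(eq_card (_ : [set p : F * F | true && (p.1 * p.2 == c)] =i _)) //.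
rewrite (card_pairs xpredT (fun x y => x * y == c)) (bigD1 0) //=; congr (_ + _)%N.
  have [->|c0] := eqVneq c 0.
    by rewrite mul1n; apply: eq_card => y; rewrite !inE mul0r eqxx.
  by apply/eqP; rewrite cards_eq0; apply/eqP/setP=> y; rewrite !inE mul0r eq_sym (negPf c0).
rewrite (eq_bigr (fun=> 1%N)) => [|x x0].
  rewrite sum_nat_const muln1 subn1 -(cardC1 (0 : F)); apply: eq_card => x.
  by rewrite !inE.
apply/eqP/cards1P; exists (x^-1 * c); apply/setP=> y; rewrite !inE.
by rewrite -(can2_eq (mulKf x0) (mulVKf x0)).
Qed.

(** The map is at most two-to-one and takes the value [c] only at 0, so [q] is at most twice the
    number of values minus one. *)
Lemma card_square_values (a c : F) : a != 0 ->
  (q < 2 * #|[set (a * x ^+ 2 + c)%R | x : F]|)%N.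
Proof.
move=> a0; set A := [set _ | x : F].
have cA : c \in A by apply/imsetP; exists 0; rewrite // expr0n mulr0 add0r.
have fib s : (#|[set x in [set: F] | (a * x ^+ 2 + c)%R == s]| <= 2 - (s == c) )%N.
  have [->|sc] /= := eqVneq s c.
    apply: (@leq_trans #|[set (0 : F)]|); last by rewrite cards1.
    apply: subset_leq_card; apply/subsetP => x.
    by rewrite !inE -[X in _ == X]add0r (inj_eq (addIr c)) mulf_eq0 (negPf a0) expf_eq0.
  set S := [set x in _ | _]; have [->|[x0]] := set_0Vmem S; first by rewrite cards0.
  rewrite !inE => /eqP x0E; have := cards2 x0 (- x0).
  have /subset_leq_card: S \subset [set x0; - x0].
    apply/subsetP=> x; rewrite !inE -x0E => /eqP/addIr/(mulfI a0)/eqP.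
    by rewrite eqf_sqr.
  by move=> + E; rewrite E; case: (x0 != _) => // /leq_trans->.
have := card_fibers [set: F] (fun x => a * x ^+ 2 + c); rewrite cardsT => ->.
rewrite (bigID (mem A)) /= [X in (_ + X)%N]big1 ?addn0 => [|s sA]; last first.
  apply/eqP; rewrite cards_eq0; apply/eqP/setP=> x; rewrite !inE; apply/negP.
  by move=> /eqP sE; case/negP: sA; apply/imsetP; exists x.
rewrite (bigD1 c) //=; apply: (@leq_ltn_trans (1 + \sum_(i in A | i != c) 2)).
  apply: leq_add; first by have := fib c; rewrite eqxx.
  by apply: leq_sum => s /andP[_ /negPf sc]; have := fib s; rewrite sc.
rewrite sum_nat_const (cardsD1 c A) cA.
have -> : #|[pred i in A | i != c]| = #|A :\ c|.
  by apply: eq_card => x; rewrite !inE andbC.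
by rewrite mulnDr muln1 mulnC ltn_add2r.
Qed.

(** Pigeonhole: the values of [a x^2 + c] and those of [- b y^2] each fill more than half of the
    field, so the two sets meet. *)
Lemma diagonal_binary_universal (a b c : F) : a != 0 -> b != 0 ->
  exists x y, a * x ^+ 2 + b * y ^+ 2 + c = 0.
Proof.
move=> a0 b0; have b0' : - b != 0 by rewrite oppr_eq0.
have := card_square_values c a0; have := card_square_values 0 b0'.
set A := [set _ | x : F]; set B := [set _ | x : F] => hA hB.
have: (q < #|A| + #|B|)%N by lia.
rewrite -cardsUI => h; have: (0 < #|A :&: B|)%N.
  have hm : (#|A :|: B| <= q)%N by exact: max_card.
  by rewrite -(ltn_add2l q) addn0 (leq_trans h) // leq_add2r.
case/card_gt0P => s /setIP[/imsetP[y _ ->] /imsetP[x _ /eqP E]].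
exists x, y; apply/eqP; rewrite addrAC -(eqP E); apply/eqP; ring.
Qed.

Lemma square_root_char2 (c : F) : (2%:R : F) = 0 -> exists x, x ^+ 2 = c.
Proof.
move=> F2; have inj : injective (fun x : F => x ^+ 2).
  move=> x y /eqP; rewrite eqf_sqr => /orP[/eqP-> //|/eqP->].
  by apply/eqP; rewrite eq_sym -addr_eq0 -mulr2n -mulr_natl F2 mul0r.
by exists (invF inj c); rewrite (f_invF inj).
Qed.
End FieldCounting.

(** * Polar identities and hyperbolic pairs *)

Section QuadraticSpaces.
Variables (F : finFieldType) (V0 : vectType F).
Local Notation V := (finvect_type V0).
Local Notation q := #|F|.
Variable eta : V -> F.
Hypothesis etaQ : is_quadratic_form eta.
Local Notation B := (polar eta).
Implicit Types (U W T K : {vspace V}) (u v w e f : V).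

Lemma etaZ a v : eta (a *: v) = a ^+ 2 * eta v.
Proof. by case: etaQ. Qed.

Lemma eta0 : eta 0 = 0.
Proof. by rewrite -(scale0r 0) etaZ expr0n mul0r. Qed.

Lemma etaD u v : eta (u + v) = eta u + eta v + B u v.
Proof. rewrite /polar; ring. Qed.

Lemma polar_bilin : bilin B.
Proof. by case: etaQ. Qed.

Let Bl u : scalar (B u). Proof. by case: polar_bilin. Qed.
Let Br u : scalar (B^~ u). Proof. by case: polar_bilin. Qed.

Lemma polarC u v : B u v = B v u.
Proof. by rewrite /polar [u + v]addrC; ring. Qed.

Lemma polarDr u v w : B u (v + w) = B u v + B u w.
Proof. exact: (linD _ _ (Bl u)). Qed.
Lemma polarDl u v w : B (u + v) w = B u w + B v w.
Proof. exact: (linD _ _ (Br w)). Qed.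
Lemma polarZr a u v : B u (a *: v) = a * B u v.
Proof. exact: (linZ _ _ (Bl u)). Qed.
Lemma polarZl a u v : B (a *: u) v = a * B u v.
Proof. exact: (linZ _ _ (Br v)). Qed.

Lemma polarvv v : B v v = eta v *+ 2.
Proof. rewrite /polar -mulr2n -scaler_nat etaZ; ring. Qed.

Definition nsing U := #|[set v in U | eta v == 0]|.

Definition hyperbolic_pair e f := [/\ eta e = 0, eta f = 0 & B e f = 1].

(** Subtracting [(eta v / B u v) u] from [v] makes it singular without changing its product with
    [u], and a rescaling makes that product 1. *)
Lemma hyperbolic_partner U u v : u \in U -> v \in U ->
  eta u = 0 -> B u v != 0 -> exists2 f, f \in U & hyperbolic_pair u f.
Proof.
move=> uU vU u0 uv; pose f := (B u v)^-1 *: (v - (eta v / B u v) *: u).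
have Buu : B u u = 0 by rewrite polarvv u0 mul0rn.
exists f; first by rewrite memvZ // memvB // memvZ.
split=> //; rewrite /f -scaleNr.
  by rewrite etaZ etaD etaZ polarZr u0 (polarC v u); field.
by rewrite polarZr polarDr polarZr Buu; field.
Qed.

Section HyperbolicSplit.
Variables (e f : V) (U' : {vspace V}).
Hypothesis ef : hyperbolic_pair e f.
Hypothesis eU' : forall w, w \in U' -> B e w = 0.
Hypothesis fU' : forall w, w \in U' -> B f w = 0.
Let U := (U' + <[e]> + <[f]>)%VS.

Lemma eta_split w x y : w \in U' -> eta (w + x *: e + y *: f) = eta w + x * y.
Proof.
move=> wU'; have [e0 f0 Bef] := ef.
rewrite !etaD !etaZ e0 f0 !polarDl !polarZl !polarZr Bef (polarC w) (polarC w).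
by rewrite eU' // fU' //; ring.
Qed.

(** The decomposition [v = w + x e + y f] is unique, because [x = B f v] and [y = B e v]. *)
Lemma card_split (P : pred V) :
  #|[set v in U | P v]| =
  (\sum_(w in U') #|[set p : F * F | P (w + p.1 *: e + p.2 *: f)%R]|)%N.
Proof.
have [e0 f0 Bef] := ef.
have Bee : B e e = 0 by rewrite polarvv e0 mul0rn.
have Bff : B f f = 0 by rewrite polarvv f0 mul0rn.
rewrite -(card_pairs (mem U') (fun w (p : F * F) => P (w + p.1 *: e + p.2 *: f))).
set S := [set p : V * (F * F) | _]; pose g (t : V * (F * F)) := t.1 + t.2.1 *: e + t.2.2 *: f.
have gE t : t \in S -> B e (g t) = t.2.2 /\ B f (g t) = t.2.1.
  rewrite inE => /andP[wU _]; rewrite /g !polarDr !polarZr Bee Bff Bef (polarC f e) Bef.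
  by rewrite eU' // fU' // !mulr0 !mulr1 !addr0 !add0r.
have gK : {in S, cancel g (fun v => (v - B f v *: e - B e v *: f, (B f v, B e v)))}.
  move=> [w [x y]] /gE /= [-> ->]; rewrite /g /=; congr (_, _).
  by rewrite [w + _ + _]addrAC !addrK.
rewrite -(card_in_imset (can_in_inj gK)).
apply: eq_card => v; rewrite inE; apply/andP/imsetP => [[vU Pv]|[[w [x y]]]].
  move: vU Pv => /memv_addP[_ /memv_addP[w wU [_ /vlineP[x ->] ->]] [_ /vlineP[y ->] ->]] Pv.
  by exists (w, (x, y)) => //; rewrite inE; apply/andP.
rewrite inE /= => /andP[wU Pv] ->; split=> //.
by rewrite !memv_add // ?memvZ ?memv_line.
Qed.

End HyperbolicSplit.
End QuadraticSpaces.

(** * Splitting off hyperbolic planes *)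

Section WittDecomposition.
Variables (F : finFieldType) (V0 : vectType F).
Local Notation V := (finvect_type V0).
Local Notation q := #|F|.
Variable eta : V -> F.
Hypothesis etaQ : is_quadratic_form eta.
Local Notation B := (polar eta).
Local Notation N0 := (nsing eta).
Implicit Types (U W T K : {vspace V}) (u v w e f : V).
Let Bl u : scalar (B u). Proof. by case: (polar_bilin etaQ). Qed.

Lemma dim_split e f U : hyperbolic_pair eta e f ->
  (forall w, w \in U -> B e w = 0) -> (forall w, w \in U -> B f w = 0) ->
  \dim (U + <[e]> + <[f]>) = (\dim U).+2.
Proof.
move=> ef eU fU; apply: (@expnI q); rewrite ?q_gt1 // -card_vs.
transitivity #|[set v in (U + <[e]> + <[f]>)%VS | xpredT v]|.
  by apply: eq_card => v; rewrite !inE andbT.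
rewrite (card_split etaQ) // (eq_bigr (fun=> (q * q)%N)) => [|w _].
  rewrite sum_nat_const !expnS [RHS]mulnA [RHS]mulnC -card_vs; congr (_ * _)%N.
  by apply: eq_card => v; rewrite !inE.
by rewrite -card_prod -cardsT; apply: eq_card => p; rewrite !inE.
Qed.

(** Since [eta (w + x e + y f) = eta w + x y], each [w] contributes the number of points of the
    hyperbola [x y = - eta w]. *)
Lemma nsing_split e f U : hyperbolic_pair eta e f ->
  (forall w, w \in U -> B e w = 0) -> (forall w, w \in U -> B f w = 0) ->
  N0 (U + <[e]> + <[f]>) = ((q - 1) * q ^ \dim U + q * N0 U)%N.
Proof.
move=> ef eU fU; rewrite /nsing (card_split etaQ ef eU fU (fun v => eta v == 0)).
rewrite (eq_bigr (fun w => (eta w == 0%R) * q + (q - 1)))%N => [|w wU].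
  rewrite big_split /= addnC sum_nat_const mulnC -card_vs; congr (_ * _ + _)%N.
    by apply: eq_card => v; rewrite !inE.
  rewrite -big_distrl /= mulnC; congr (_ * _)%N; rewrite -sum1_card.
  rewrite [RHS](eq_bigl (fun v => (v \in U) && (eta v == 0))) => [|v]; last by rewrite !inE.
  by rewrite big_mkcondr; apply: eq_bigr => v _; case: (_ == _).
rewrite -(oppr_eq0 (eta w)) -card_hyperbola; apply: eq_card => p; rewrite !inE.
by rewrite (eta_split etaQ ef eU fU) // addrC addr_eq0.
Qed.

Lemma hyperbolic_decomposition e f U : hyperbolic_pair eta e f -> e \in U -> f \in U ->
  U = (U :&: kerf (B e) :&: kerf (B f) + <[e]> + <[f]>)%VS.
Proof.
move=> [e0 f0 Bef] eU fU; apply/vspaceP => v; apply/idP/idP => [vU|].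
  have Bee : B e e = 0 by rewrite polarvv // e0 mul0rn.
  have Bff : B f f = 0 by rewrite polarvv // f0 mul0rn.
  have -> : v = (v - B f v *: e - B e v *: f) + B f v *: e + B e v *: f.
    by rewrite [_ - _ + _ in RHS]addrAC !subrK.
  rewrite !memv_add ?memvZ ?memv_line // !memv_cap !mem_kerf // -!scaleNr.
  rewrite !polarDr // !polarZr // Bee Bff Bef (polarC _ f e) Bef !memvD ?memvZ //=.
  by apply/andP; split; apply/eqP; ring.
move=> /memv_addP[_ /memv_addP[w + [_ /vlineP[x ->] ->]] [_ /vlineP[y ->] ->]].
by rewrite !memv_cap => /andP[/andP[wU _] _]; rewrite !memvD ?memvZ.
Qed.

Definition totsing T := forall v, v \in T -> eta v = 0.

Lemma totsing_polar T u v : totsing T -> u \in T -> v \in T -> B u v = 0.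
Proof. by move=> Ts uT vT; rewrite /polar !Ts ?memvD // !subr0. Qed.

Lemma totsing_add T v : totsing T -> eta v = 0 -> (forall w, w \in T -> B w v = 0) ->
  totsing (T + <[v]>).
Proof.
move=> Ts v0 Tv _ /memv_addP[w wT [_ /vlineP[x ->] ->]].
by rewrite etaD etaZ // polarZr // v0 Ts // Tv // !mulr0 !addr0.
Qed.

(** The singular part of the radical of [eta] restricted to [U]. It is closed under sums because the
    polar form vanishes on it. *)
Definition radQ U : {vspace V} := solutions
  [pred v : V | [&& v \in U, eta v == 0 & [forall w : V, (w \in U) ==> (B v w == 0)]]].

Lemma radQP U v : reflect [/\ v \in U, eta v = 0 & forall w, w \in U -> B v w = 0]
  (v \in radQ U).
Proof.
rewrite mem_solutions /=.
- apply: (iffP and3P) => [[vU /eqP v0 /forallP h]|[vU v0 h]]; split=> //.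
  + by move=> w wU; apply/eqP/(implyP (h w)).
  + exact/eqP.
  + by apply/forallP => w; apply/implyP => wU; apply/eqP/h.
- rewrite mem0v eta0 // eqxx; apply/forallP => w; apply/implyP => _.
  by rewrite -(scale0r 0) polarZl // mul0r.
move=> a u w /and3P[uU /eqP u0 /forallP hu] /and3P[wU /eqP w0 /forallP hw].
have {}hu x : x \in U -> B u x = 0 by move=> xU; apply/eqP/(implyP (hu x)).
have {}hw x : x \in U -> B w x = 0 by move=> xU; apply/eqP/(implyP (hw x)).
apply/and3P; split; first by rewrite memvD ?memvZ.
  by rewrite etaD etaZ // polarZl // u0 w0 hu // !mulr0 !addr0.
apply/forallP => x; apply/implyP => xU.
by rewrite polarDl // polarZl // hu // hw // mulr0 addr0.
Qed.

(** In characteristic 2, two independent orthogonal vectors suffice, because [eta v / eta u] is a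
    square. In odd characteristic three pairwise orthogonal vectors are taken, and
    [diagonal_binary_universal] solves the resulting diagonal equation with third coefficient 1. *)
Lemma three_dim_isotropic U : (2 < \dim U)%N ->
  exists v, [/\ v \in U, v != 0 & eta v = 0].
Proof.
move=> U3; have [|u uU u0] := @exists_nonzero _ _ U; first exact: ltn_trans U3.
have [eu|eu] := eqVneq (eta u) 0; first by exists u.
set U1 := (U :&: kerf (B u))%VS.
have U1d : (1 < \dim U1)%N by have := dim_kerf_ge U (Bl u); rewrite -/U1; lia.
have U1P v : v \in U1 -> v \in U /\ B u v = 0.
  by rewrite memv_cap mem_kerf // => /andP[-> /eqP].
have [F2|F2] := eqVneq (2%:R : F) 0.
  have [|v vU1 vu] := @exists_notin _ _ U1 <[u]>; first by rewrite dim_vline u0.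
  have [vU uv] := U1P v vU1.
  have [x xE] := square_root_char2 (eta v / eta u) F2.
  exists (x *: u + v); split; first by rewrite memvD ?memvZ.
    apply: contra vu; rewrite addrC addr_eq0 => /eqP->.
    by rewrite memvN memvZ // memv_line.
  by rewrite etaD etaZ // polarZl // uv xE mulfVK // mulr0 addr0 -mulr2n -mulr_natl F2 mul0r.
have [|v vU1 v0] := @exists_nonzero _ _ U1; first exact: ltnW.
have [vU uv] := U1P v vU1.
have [ev|ev] := eqVneq (eta v) 0; first by exists v.
set U2 := (U1 :&: kerf (B v))%VS.
have [|w wU2 w0] := @exists_nonzero _ _ U2.
  by have := dim_kerf_ge U1 (Bl v); rewrite -/U2; lia.
have [wU1 vw] : w \in U1 /\ B v w = 0.
  by move: wU2; rewrite memv_cap mem_kerf // => /andP[-> /eqP].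
have [wU uw] := U1P w wU1.
have [ew|ew] := eqVneq (eta w) 0; first by exists w.
have [x [y xyE]] := diagonal_binary_universal (eta w) eu ev.
exists (x *: u + y *: v + w); split; first by rewrite !memvD ?memvZ.
  apply: contraNneq ew => /(congr1 (B w)).
  rewrite (lin0 (Bl w)) !polarDr // !polarZr // (polarC _ w u) (polarC _ w v) uw vw polarvv //.
  by rewrite !mulr0 !add0r => /eqP; rewrite -mulr_natl mulf_eq0 (negPf F2).
by rewrite !etaD !(etaZ etaQ) polarDl // !polarZl // !polarZr // uv uw vw !mulr0 !addr0 -xyE; ring.
Qed.

(* [U] is an orthogonal sum of [k] hyperbolic planes, a totally singular radical
   of dimension [r] and an anisotropic space of dimension [a]; [K] is the sum of
   the hyperbolic planes. *)
Definition witt_type U k r a := [/\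
  [/\ \dim U = (k + k + r + a)%N, (a <= 2)%N & \dim (radQ U) = r],
  (q * N0 U + q ^ (\dim U - k) = q ^ \dim U + q ^ (k + r).+1)%N,
  exists T, [/\ (T <= U)%VS, \dim T = (k + r)%N & totsing T],
  a = 0%N -> forall v, v \in U -> (forall w, w \in U -> B v w = 0) -> eta v = 0 &
  exists K, [/\ (K <= U)%VS, \dim K = (k + k)%N &
    (q * N0 K + q ^ k = q ^ (k + k) + q ^ k.+1)%N] ].

(** Induction on the dimension: a singular vector of [U] that is not orthogonal to [U] lies in a
    hyperbolic plane, which is split off and raises [k] by one. *)
Lemma witt_decomposition U : exists k r a, witt_type U k r a.
Proof.
have [m] := ubnP (\dim U); elim: m U => // m IH U Um.
have [/existsP[u /existsP[v /and4P[uU vU /eqP u0 uv]]]|noU] := boolP [exists u : V, exists v : V,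
    [&& u \in U, v \in U, eta u == 0 & B u v != 0]].
  have [f fU ef] := hyperbolic_partner etaQ uU vU u0 uv; have [_ f0 Buf] := ef.
  set U' := (U :&: kerf (B u) :&: kerf (B f))%VS.
  have U'P w : w \in U' -> [/\ w \in U, B u w = 0 & B f w = 0].
    by rewrite !memv_cap !mem_kerf // => /andP[/andP[-> /eqP-> /eqP->]].
  have UE : U = (U' + <[u]> + <[f]>)%VS := hyperbolic_decomposition ef uU fU.
  have uU' w : w \in U' -> B u w = 0 by case/U'P.
  have fU' w : w \in U' -> B f w = 0 by case/U'P.
  have dU : \dim U = (\dim U').+2 by rewrite UE dim_split.
  have [|k [r [a [[dU' a2 rU'] cN [T [TU' dT Ts]] aU' [K [KU' dK cK]]]]]] := IH U'.
    by rewrite dU in Um; lia.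
  (* Here and in [radE']: splitting off the plane leaves the radical unchanged. *)
  have radE w : w \in U' -> (forall x, x \in U' -> B w x = 0) -> forall x, x \in U -> B w x = 0.
    move=> wU' h x; rewrite UE => /memv_addP[_ /memv_addP[y yU' [_ /vlineP[b ->] ->]] [_ /vlineP[c ->] ->]].
    by rewrite !polarDr // !polarZr // h // !(polarC _ w) uU' // fU' // !mulr0 !addr0.
  have radE' w : w \in U -> (forall x, x \in U -> B w x = 0) -> w \in U'.
    by move=> wU h; rewrite !memv_cap !mem_kerf // wU !(polarC _ _ w) !h // eqxx.
  exists k.+1, r, a; split.
  - split=> //; first by rewrite dU dU' addSn addnS.
    rewrite -rU'; congr (\dim _); apply/vspaceP => w; apply/radQP/radQP => -[wU w0 h].
      have wU' := radE' _ wU h; split=> // x /U'P[xU _ _]; exact: h.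
    by have [wU'' _ _] := U'P _ wU; split=> //; exact: radE.
  - rewrite [in N0 U]UE nsing_split // dU subSS subSn; last by rewrite dU'; lia.
    rewrite mulnDr [(k.+1 + r)%N]addSn !expnS; move: cN; rewrite !expnS.
    have := q_gt1 F; move: (q ^ (_ - _))%N (q ^ (k + r))%N (q ^ \dim U')%N (N0 U').
    by move: q => Q; nia.
  - exists (T + <[u]>)%VS; split.
    + by rewrite subv_add -memvE uU andbT (subv_trans TU') // UE -addvA addvSl.
    + rewrite dim_add_line ?dT //; apply/negP => /(subvP TU')/fU'.
      by rewrite polarC Buf => /eqP; rewrite oner_eq0.
    + by apply: totsing_add => // w /(subvP TU')/uU'; rewrite polarC.
  - move=> a0 w wU h; apply: aU' => //; first exact: radE'.
    by move=> x /U'P[xU _ _]; exact: h.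
  exists (K + <[u]> + <[f]>)%VS.
  have uK w : w \in K -> B u w = 0 by move/(subvP KU')/uU'.
  have fK w : w \in K -> B f w = 0 by move/(subvP KU')/fU'.
  split.
  - by rewrite UE !addvS ?subvv.
  - by rewrite dim_split // dK addSn addnS.
  rewrite nsing_split // dK addSn addnS !expnS mulnDr; move: cK; rewrite !expnS.
  have := q_gt1 F; move: (q ^ (k + k))%N (q ^ k)%N (N0 K).
  by move: q => Q; nia.
(* Base case: the singular vectors of [U] are exactly those of [radQ U], so a complement of it is
   anisotropic and has dimension at most 2. *)
have perp u v : u \in U -> eta u = 0 -> v \in U -> B u v = 0.
  move=> uU u0 vU; apply/eqP; apply: contraNT noU => uv.
  by apply/existsP; exists u; apply/existsP; exists v; rewrite uU vU u0 eqxx.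
have sR v : v \in U -> eta v = 0 -> v \in radQ U.
  by move=> vU v0; apply/radQP; split=> // w; apply: perp.
have RU : (radQ U <= U)%VS by apply/subvP => v /radQP[].
have dUR := dimv_cap_compl U (radQ U); rewrite (capv_idPr RU) in dUR.
exists 0%N, (\dim (radQ U)), (\dim (U :\: radQ U)); split.
- split=> //; rewrite leqNgt; apply/negP => /three_dim_isotropic[v [vUR v0 ev]].
  have vR : v \in radQ U by apply: sR => //; apply: (subvP (diffvSl _ _)) vUR.
  case/negP: v0; rewrite -memv0 -(capv_diff U (radQ U)) memv_cap vUR //.
- have -> : N0 U = (q ^ \dim (radQ U))%N.
    rewrite -card_vs; apply: eq_card => v; rewrite !inE.
    by apply/andP/idP => [[vU /eqP]|/radQP[-> ->]] //; apply: sR.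
  by rewrite subn0 add0n addnC expnS.
- by exists (radQ U); split=> // v /radQP[].
- move=> a0 v; rewrite -{1}(addv_diff_cap U (radQ U)).
  move/eqP: a0; rewrite dimv_eq0 => /eqP->; rewrite add0v (capv_idPr RU).
  by case/radQP.
exists 0%VS; split; rewrite ?sub0v ?dimv0 // addn0 expn0 mulnC expn1 addnC.
suff -> : N0 0%VS = 1%N by rewrite mul1n.
rewrite /nsing -(cards1 (0 : V)); apply: eq_card => v; rewrite !inE memv0.
by apply/andb_idr => /eqP->; rewrite eta0.
Qed.
(** Here [dim U - k = k + r + a] is at least [k + r + 1], so the correction terms in the count have
    a nonpositive sum. *)
Lemma nsing_nonhyperbolic U k r a : witt_type U k r a -> (0 < a)%N ->
  (q * N0 U <= q ^ \dim U)%N.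
Proof.
move=> [[dU _ _] cN _ _ _] a0.
have : (q ^ (k + r).+1 <= q ^ (\dim U - k))%N by rewrite leq_pexp2l ?q_gt0 //; lia.
by move: cN; lia.
Qed.

(** With [r = 0] the dimension is [2k + a], so odd parity excludes [a = 0]. *)
Lemma nsing_odd_dim U : odd (\dim U) -> radQ U = 0%VS -> (q * N0 U <= q ^ \dim U)%N.
Proof.
move=> dU rU; have [k [r [a wU]]] := witt_decomposition U; have := wU.
move=> [[dV _ rV] _ _ _ _]; rewrite rU dimv0 in rV.
apply: (nsing_nonhyperbolic wU); rewrite lt0n; apply: contraTneq dU => a0.
by rewrite dV -rV a0 !addn0 addnn odd_double.
Qed.

(** Either [a > 0], with at most [q] singular vectors, or [L] is a hyperbolic plane, with [2q - 1]
    of them. *)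
Lemma nsing_plane L : \dim L = 2%N -> ~ totsing L -> (N0 L < q + q)%N.
Proof.
move=> dL Lns; have [k [r [a wL]]] := witt_decomposition L; have := wL.
have q1 := q_gt1 F.
move=> [[dV a2 rV] cN [T [TL dT Ts]] _ _].
case: (posnP a) => [a0|a_gt0]; last first.
  by have := nsing_nonhyperbolic wL a_gt0; rewrite dL expnS expn1 leq_pmul2l ?q_gt0 //; lia.
have [k1 r0] : k = 1%N /\ r = 0%N.
  have [k0|] := posnP k; last by lia.
  case: Lns; have /eqP <- // : T == L by rewrite eqEdim TL dT; lia.
move: cN; rewrite dL k1 r0 !expnS !expn0; move: q q1 (N0 L) => Q Q1 N; nia.
Qed.
End WittDecomposition.

(** * Non-degenerate forms in odd dimension *)

Section AlternatingForms.
Variables (F : finFieldType) (V0 : vectType F).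
Local Notation V := (finvect_type V0).
Variable b : V -> V -> F.
Hypotheses (bL : bilin b) (b0 : forall v, b v v = 0).
Implicit Types (X U : {vspace V}).

Lemma alternatingN u v : b v u = - b u v.
Proof.
apply/eqP; rewrite -addr_eq0; apply/eqP.
have := b0 (v + u); rewrite bilDr // !bilDl //.
by rewrite !b0 add0r addr0 addrC.
Qed.

Lemma alternating_perp u v : b u v = 0 -> b v u = 0.
Proof. by rewrite (alternatingN u v) => ->; rewrite oppr0. Qed.

(** A maximal isotropic [X] is its own orthogonal and contains the radical, so twice [dim X] equals
    [dim V] plus the dimension of the radical. *)
Lemma odd_dim_radical : odd (\dim (orth (flip b) {:V})) = odd (\dim {:V}).
Proof.
have fL := flip_bilin bL.
pose iso X := [forall u : V, forall v : V, (u \in X) && (v \in X) ==> (b u v == 0)].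
have isoP X : reflect (forall u v, u \in X -> v \in X -> b u v = 0) (iso X).
  apply: (iffP forallP) => [h u v uX vX|h u].
    by have /forallP/(_ v)/implyP := h u; rewrite uX vX => /(_ isT)/eqP.
  by apply/forallP => v; apply/implyP => /andP[uX vX]; apply/eqP/h.
have iso0 : iso 0%VS.
  by apply/isoP => u v; rewrite !memv0 => /eqP-> _; rewrite bil0l.
case: (arg_maxnP (fun X => \dim X) iso0) => X /isoP Xiso Xmax.
have oX v : v \in orth b X -> v \in X.
  move/(orthP X v bL) => vX; apply/negPn/negP => vnX.
  have: iso (X + <[v]>)%VS.
    apply/isoP => _ _ /memv_addP[x xX [_ /vlineP[k ->] ->]] /memv_addP[y yX [_ /vlineP[l ->] ->]].
    rewrite bilDr // !bilDl // !bilZr // !bilZl //.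
    by rewrite Xiso // b0 vX // (alternating_perp (vX y yX)) !mulr0 !addr0.
  by move/Xmax => /=; rewrite dim_add_line // ltnn.
have := dim_orth_pairing X {:V} bL; rewrite capfv.
have -> : orth b X = X.
  apply/vspaceP => v; apply/idP/idP => [/oX //|vX].
  by apply/(orthP _ _ bL) => u uX; exact: Xiso.
rewrite (capv_idPr _); last first.
  apply/subvP => v /(orthP _ _ fL) vR; apply: oX; apply/(orthP _ _ bL) => u _.
  exact/alternating_perp/(vR u (memvf u)).
by move/(congr1 odd); rewrite !oddD addbb; case: odd; case: odd.
Qed.
End AlternatingForms.

(** * Singular vectors of the whole space, of tangent hyperplanes and in codimension two *)

Section ParabolicSpaces.
Variables (F : finFieldType) (V0 : vectType F).
Local Notation V := (finvect_type V0).
Local Notation q := #|F|.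
Variable eta : V -> F.
Hypothesis etaQ : is_quadratic_form eta.
Local Notation B := (polar eta).
Local Notation N0 := (nsing eta).
Hypothesis eta_nd : nondegenerate_quadratic_form eta.
Variable m : nat.
Hypothesis dimV : \dim {:V} = (m + m).+3.
Implicit Types (U W T K R L : {vspace V}) (u v w e f : V).
Let BL := polar_bilin etaQ.
Let Bl u : scalar (B u). Proof. by case: BL. Qed.

Lemma perpP U v : reflect (forall u, u \in U -> B u v = 0) (v \in orth B U).
Proof. exact: orthP. Qed.

(** The last term accounts for the radical of the polar form, which is nonzero in characteristic
    2. *)
Lemma dim_perp U :
  (\dim U + \dim (orth B U) = (m + m).+3 + \dim (U :&: orth B {:V}))%N.
Proof.
have := dim_orth_pairing U {:V} BL; rewrite capfv dimV => ->; congr (_ + \dim (_ :&: _))%N.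
apply/vspaceP => v; apply/orthP/perpP => [|h u _|h u uV]; first exact: flip_bilin.
  by rewrite polarC; apply: h; rewrite memvf.
by rewrite /flip polarC h.
Qed.

Lemma singular_radical v : v \in orth B {:V} -> eta v = 0 -> v = 0.
Proof. by move=> /perpP vR v0; apply: eta_nd => // w; rewrite polarC vR ?memvf. Qed.

(** [T] lies in its own orthogonal and, by non-degeneracy, meets the radical of the polar form
    trivially. *)
Lemma totsing_dim T : totsing eta T -> (\dim T <= m.+1)%N.
Proof.
move=> Ts; have := dim_perp T.
have -> : (T :&: orth B {:V} = 0)%VS.
  apply/eqP; rewrite -subv0; apply/subvP => v; rewrite memv_cap => /andP[vT vR].
  by rewrite memv0; apply/eqP/singular_radical/Ts.
suff /dimvS : (T <= orth B T)%VS by rewrite dimv0; lia.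
by apply/subvP => v vT; apply/perpP => u uT; apply: (totsing_polar Ts).
Qed.

Lemma dim_radQ_full : \dim (radQ eta {:V}) = 0%N.
Proof.
apply/eqP; rewrite dimv_eq0 -subv0; apply/subvP => v /(radQP etaQ)[_ v0 vV].
by rewrite memv0; apply/eqP/eta_nd => // w; apply: vV; rewrite memvf.
Qed.

(** With [r = 0] and [a <= 2], the odd dimension forces [k = m + 1] and [a = 1], and the correction
    terms of the count cancel. *)
Lemma nsing_full : N0 {:V} = (q ^ (m + m).+2)%N.
Proof.
have [k [r [a [[dV a2 rV] cN _ _ _]]]] := witt_decomposition etaQ {:V}.
move: dV cN rV; rewrite dimV dim_radQ_full => dV cN r0.
have [kE a1] : k = m.+1 /\ a = 1%N by lia.
rewrite {}kE in cN.
have q0 := q_gt0 F; move: cN; rewrite -r0.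
have -> : ((m + m).+3 - m.+1 = m.+2)%N by lia.
by rewrite addn0 => /addIn; rewrite expnS => /eqP; rewrite eqn_pmul2l // => /eqP.
Qed.

Lemma exists_nonperp u : eta u = 0 -> u != 0 -> exists v, B u v != 0.
Proof.
move=> u0 /eqP un0; have [/existsP //|/existsPn h] := boolP [exists v, B u v != 0].
by case: un0; apply: eta_nd => // w; apply/eqP/negPn/h.
Qed.

Lemma dim_perp_line u : eta u = 0 -> u != 0 -> \dim (kerf (B u)) = (m + m).+2.
Proof.
move=> u0 un0; have [v uv] := exists_nonperp u0 un0.
by have := dim_kerf (Bl u) (memvf v) uv; rewrite capfv dimV => -[].
Qed.

(** The radical of the tangent hyperplane is the line of [u], so [r = 1], and the dimension forces
    [k = m] and [a = 1]. *)
Lemma nsing_perp_line u : eta u = 0 -> u != 0 -> N0 (kerf (B u)) = (q ^ (m + m).+1)%N.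
Proof.
move=> u0 un0; have Buu : B u u = 0 by rewrite polarvv // u0 mul0rn.
have dU := dim_perp_line u0 un0.
have radE : radQ eta (kerf (B u)) = <[u]>%VS.
  apply/vspaceP => v; apply/(radQP etaQ)/vlineP => [[vU v0 vh]|[k ->]].
    (* A radical vector [v] satisfies [B v = l B u]; then [v - l u] is singular and orthogonal to
       everything, hence zero. *)
    have [|l lE] := proportional (Bl u) (Bl v).
      by move=> w uw; apply: vh; rewrite mem_kerf ?uw.
    exists l; apply/subr0_eq/eta_nd => [|w]; last first.
      by rewrite -scaleNr polarDl // polarZl // lE; ring.
    rewrite -scaleNr etaD etaZ // v0 u0 polarZr // polarC.
    by move: vU; rewrite mem_kerf // => /eqP->; rewrite !mulr0 !addr0.
  rewrite mem_kerf // polarZr // Buu mulr0 eqxx etaZ // u0 mulr0; split=> // w.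
  by rewrite mem_kerf // polarZl // => /eqP->; rewrite mulr0.
have [k [r [a [[dV a2 rV] cN _ _ _]]]] := witt_decomposition etaQ (kerf (B u)).
move: dV cN rV; rewrite dU radE dim_vline un0 => dV cN r1.
have [kE a1] : k = m /\ a = 1%N by lia.
rewrite {}kE in cN.
have q0 := q_gt0 F; move: cN; rewrite -r1.
have -> : ((m + m).+2 - m = m.+2)%N by lia.
by rewrite addn1 => /addIn; rewrite expnS => /eqP; rewrite eqn_pmul2l // => /eqP.
Qed.

(** For [a = 0] the count is [q^(2m) + q^(k+r) - q^(k+r-1)], increasing in [k + r], and [k + r] is
    the dimension of a totally singular subspace, at most [m + 1]. *)
Lemma nsing_codim2 U : \dim U = (m + m).+1 ->
  (N0 U + q ^ m <= q ^ (m + m) + q ^ m.+1)%N.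
Proof.
move=> dU; have q1 := q_gt1 F.
have [k [r [a wU]]] := witt_decomposition etaQ U; have := wU.
move=> [[dV a2 rV] cN [T [_ dT /totsing_dim Tm]] _ _].
have le1 : (q ^ m <= q ^ m.+1)%N by rewrite leq_pexp2l ?q_gt0.
case: (posnP a) => [a0|a_gt0]; last first.
  have := nsing_nonhyperbolic wU a_gt0; rewrite dU expnS leq_pmul2l ?q_gt0 //; lia.
have kr : (k + r <= m.+1)%N by rewrite -dT.
have E : (\dim U - k = k + r)%N by lia.
move: cN; rewrite E dU; have [j jE] : exists j, (k + r = j.+1)%N by exists (k + r).-1; lia.
rewrite jE in kr *; have : (q ^ j <= q ^ m)%N by rewrite leq_pexp2l ?q_gt0.
rewrite !expnS; move: (q ^ j)%N (q ^ m)%N (q ^ (m + m))%N (N0 U).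
move: q q1 => Q Q1 x y z N xy cN.
have {}cN : (N + x = z + Q * x)%N by apply/eqP; rewrite -(eqn_pmul2l (ltnW Q1)); lia.
nia.
Qed.

(** If [a = 0], then [x] and [y] lie in [radQ], so [r >= 2]; with [2k + r = 2m + 1] this contradicts
    [k + r <= m + 1]. *)
Lemma nsing_codim2_radical U x y : \dim U = (m + m).+1 ->
    x \in U -> y \in U -> x != 0 -> y \notin <[x]>%VS ->
    (forall w, w \in U -> B x w = 0) -> (forall w, w \in U -> B y w = 0) ->
  (N0 U <= q ^ (m + m))%N.
Proof.
move=> dU xU yU x0 yx xP yP; have [k [r [a wU]]] := witt_decomposition etaQ U; have := wU.
move=> [[dV _ rV] _ [T [_ dT /totsing_dim Tm]] aU _].
rewrite -(leq_pmul2l (q_gt0 F)) -expnS -dU.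
apply: (nsing_nonhyperbolic wU); rewrite lt0n; apply/eqP => a0.
have : (<[x]> + <[y]> <= radQ eta U)%VS.
  by rewrite subv_add -!memvE; apply/andP; split; apply/(radQP etaQ); split=> //; apply: aU.
by move/dimvS; rewrite dim_add_line // dim_vline x0 rV; lia.
Qed.

End ParabolicSpaces.

(** * Lower bound for the weights *)

Section Weights.
Variables (F : finFieldType) (V0 : vectType F).
Local Notation V := (finvect_type V0).
Local Notation q := #|F|.
Variable eta : V -> F.
Hypothesis etaQ : is_quadratic_form eta.
Local Notation B := (polar eta).
Local Notation N0 := (nsing eta).
Hypothesis eta_nd : nondegenerate_quadratic_form eta.
Variable m : nat.
Hypothesis dimV : \dim {:V} = (m + m).+3.
Hypothesis m_gt0 : (0 < m)%N.
Local Notation t := (q ^ m)%N.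
Variable beta : V -> V -> F.
Hypothesis betaL : bilin beta.
Hypothesis beta0 : forall v, beta v v = 0.
Implicit Types (U W T K R L : {vspace V}) (u v w x y : V) (l k : F).
Let BL := polar_bilin etaQ.
Let Bl u : scalar (B u). Proof. by case: BL. Qed.
Let betal u : scalar (beta u). Proof. by case: betaL. Qed.

Definition pencil l u v := beta u v - l * B u v.

Lemma pencil_bilin l : bilin (pencil l).
Proof.
split=> u a v w; rewrite /pencil.
  by rewrite !bilDr // !bilZr //; ring.
by rewrite !bilDl // !bilZl //; ring.
Qed.

Definition eig l : {vspace V} := orth (flip (pencil l)) {:V}.

Lemma eigP l u : reflect (forall v, beta u v = l * B u v) (u \in eig l).
Proof.
apply: (iffP (orthP _ _ (flip_bilin (pencil_bilin l)))) => h v.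
  by apply/subr0_eq/h; rewrite memvf.
by move=> _; rewrite /flip /pencil h subrr.
Qed.

(** Compare [l B u v = beta u v = - beta v u = - k B u v]. *)
Lemma eig_polar l k u v : u \in eig l -> v \in eig k -> l + k != 0 -> B u v = 0.
Proof.
move=> /eigP ul /eigP vk lk; apply: (mulfI lk); rewrite mulr0 mulrDl -ul.
by rewrite [B u v]polarC -vk (alternatingN betaL beta0 v u) addNr.
Qed.

Lemma eig_disjoint l k v : v \in eig l -> v \in eig k -> l != k -> eta v = 0 -> v = 0.
Proof.
move=> /eigP vl /eigP vk lk v0; apply: eta_nd => // w.
have /eqP : (l - k) * B v w = 0 by rewrite mulrBl -vl -vk subrr.
by rewrite mulf_eq0 subr_eq0 (negPf lk) => /eqP.
Qed.

Definition eigen_set : {set V} := [set u | (eta u == 0) && [exists l, u \in eig l]].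
Local Notation S := eigen_set.

Definition residue u : {vspace V} := (kerf (B u) :&: kerf (beta u))%VS.

Lemma mem_residue u w : (w \in residue u) = (B u w == 0) && (beta u w == 0).
Proof. by rewrite memv_cap !mem_kerf. Qed.

(* [q ^ (m + m)] is the number of singular vectors of a cone over a parabolic
   space, hence of a degenerate hyperplane section of [u^perp]. *)
Definition light_set : {set V} :=
  [set u | (eta u == 0) && ((u \in S) || (N0 (residue u) <= q ^ (m + m))%N)].
Local Notation Y := light_set.

Lemma noneigenP u : eta u = 0 -> u \notin S ->
  exists v, B u v = 0 /\ beta u v != 0.
Proof.
move=> u0 uS; have [/existsP[v /andP[/eqP uv bv]]|/existsPn h] :=
  boolP [exists v, (B u v == 0) && (beta u v != 0)]; first by exists v.
have [|l lE] := proportional (Bl u) (betal u).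
  by move=> v /eqP uv; have := h v; rewrite uv /= negbK => /eqP.
by case/negP: uS; rewrite inE u0 eqxx; apply/existsP; exists l; apply/eigP.
Qed.

Lemma zero_eigen : 0 \in S.
Proof.
rewrite inE eta0 // eqxx; apply/existsP; exists 0; exact: mem0v.
Qed.

Lemma dim_residue u : eta u = 0 -> u \notin S -> \dim (residue u) = (m + m).+1.
Proof.
move=> u0 uS; have [v [uv bv]] := noneigenP u0 uS.
have un0 : u != 0 by apply: contraNneq uS => ->; exact: zero_eigen.
have vU : v \in kerf (B u) by rewrite mem_kerf ?uv.
by have := dim_kerf (betal u) vU bv; rewrite (dim_perp_line etaQ eta_nd dimV) // => -[].
Qed.

(** The radical of [residue u] always contains [u]; a second independent radical vector makes the
    section degenerate. *)
Lemma light_radical u y : eta u = 0 -> u \notin S -> y \in residue u ->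
  y \notin <[u]>%VS -> (forall w, w \in residue u -> B y w = 0) -> u \in Y.
Proof.
move=> u0 uS yU yu yP; rewrite inE u0 eqxx (negPf uS) /=.
have un0 : u != 0 by apply: contraNneq uS => ->; exact: zero_eigen.
apply: (nsing_codim2_radical (x := u) (y := y) etaQ eta_nd dimV) => //; first exact: dim_residue.
  by rewrite mem_residue beta0 polarvv // u0 mul0rn eqxx.
by move=> w; rewrite mem_residue => /andP[/eqP].
Qed.

(** The last hypothesis puts the common orthogonal of [u] and [y] inside [residue u]. By dimension
    the two are equal, so [y] is in the radical of [residue u]. *)
Lemma light_perp u y : eta u = 0 -> u \notin S -> y \notin <[u]>%VS ->
    B u y = 0 -> beta u y = 0 ->
    (forall w, B u w = 0 -> B y w = 0 -> beta u w = 0) ->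
  u \in Y.
Proof.
move=> u0 uS yu uy buy h.
have un0 : u != 0 by apply: contraNneq uS => ->; exact: zero_eigen.
suff /eqP E : (kerf (B u) :&: kerf (B y))%VS == residue u.
  apply: (light_radical u0 uS _ yu); first by rewrite mem_residue uy buy eqxx.
  by move=> w; rewrite -E memv_cap !mem_kerf // => /andP[_ /eqP].
rewrite eqEdim dim_residue //; apply/andP; split.
  apply/subvP => w; rewrite memv_cap !mem_kerf // mem_residue => /andP[/eqP uw /eqP yw].
  by rewrite uw h ?eqxx.
have := dim_kerf_ge (kerf (B u)) (Bl y).
by rewrite (dim_perp_line etaQ eta_nd dimV).
Qed.

Definition weight_pairs : {set V * V} :=
  [set p | [&& eta p.1 == 0, eta p.2 == 0, B p.1 p.2 == 0 & beta p.1 p.2 != 0]].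

Lemma weight_at u : eta u = 0 -> u \notin S ->
  (#|[set v | [&& eta v == 0, B u v == 0 & beta u v != 0]%R]| + N0 (residue u) =
   q * q ^ (m + m))%N.
Proof.
move=> u0 uS; have un0 : u != 0 by apply: contraNneq uS => ->; exact: zero_eigen.
rewrite -expnS -(nsing_perp_line etaQ eta_nd dimV u0 un0) addnC /nsing.
rewrite -(cardsID [set v in kerf (beta u)] [set v in kerf (B u) | eta v == 0]).
congr (_ + _)%N; apply: eq_card => v; rewrite !inE ?memv_cap !mem_kerf //.
  by rewrite andbAC.
by rewrite andbC andbA; congr (_ && _); rewrite andbC.
Qed.

(** Vectors of [Y] outside [S] contribute at least [(q - 1) t^2] pairs each, and the singular
    vectors outside [Y] at least [(q - 1)(t^2 - t)]. The singular vectors number [q^2 t^2] in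
    all. *)
Lemma weight_pairs_ge :
    (#|S| * t + t * t <= #|Y| + t * t * t)%N ->
  ((q - 1) * (q * q - 1) * (t * t * t) * (t - 1) <= #|weight_pairs|)%N.
Proof.
move=> crit; have q1 := q_gt1 F.
pose Z := [set u : V | eta u == 0].
have t0 : (0 < t)%N by rewrite expn_gt0 q_gt0.
pose c u := #|[set v | [&& eta v == 0, B u v == 0 & beta u v != 0]]|.
have SY : S \subset Y by apply/subsetP => u uS; rewrite !inE in uS *; case/andP: uS => -> ->.
have Ysing : Y \subset Z.
  by apply/subsetP => u; rewrite !inE => /andP[].
have sE : #|Z| = (q * q * (t * t))%N.
  rewrite -expnD -mulnA -!expnS -(nsing_full etaQ eta_nd dimV) /nsing.
  by apply: eq_card => v; rewrite !inE memvf.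
have light u : u \in Y :\: S -> ((q - 1) * (t * t) <= c u)%N.
  move=> /setDP[+ uS]; rewrite inE => /andP[/eqP u0]; rewrite (negPf uS) /= -expnD => hN.
  have := weight_at u0 uS; rewrite -/(c u) mulnBl mul1n => <-.
  by rewrite leq_subLR addnC leq_add2r.
have heavy u : u \in Z :\: Y -> ((q - 1) * (t * t - t) <= c u)%N.
  move=> /setDP[]; rewrite inE => /eqP u0 uY.
  have uS : u \notin S by apply: contra uY; apply: (subsetP SY).
  have := weight_at u0 uS; have := nsing_codim2 etaQ eta_nd dimV (dim_residue u0 uS).
  rewrite -/(c u) expnS expnD; move: q1 (N0 _) (c u) t0.
  by move: q t => Q T; nia.
have -> : #|weight_pairs| = (\sum_(u in Z) c u)%N.
  rewrite (eq_bigl (fun u : V => eta u == 0%R)) => [|u]; last by rewrite inE.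
  rewrite -(card_pairs (fun u : V => eta u == 0%R) (fun u v : V => [&& eta v == 0, B u v == 0 & beta u v != 0]%R)).
  by apply: eq_card => p; rewrite !inE.
apply: (@leq_trans (#|Y :\: S| * ((q - 1) * (t * t)) +
                    #|Z :\: Y| * ((q - 1) * (t * t - t)))).
  have := cardsD Y S; have := cardsD Z Y.
  rewrite sE (setIidPr Ysing) (setIidPr SY) => -> ->.
  have := subset_leq_card Ysing; have := subset_leq_card SY; rewrite sE.
  move: crit q1 t0; move: #|Y| #|S| => y s; move: q t => Q T crit q1 t0 sy yT.
  have [d yE] : exists d, y = (s + d)%N by exists (y - s)%N; lia.
  have [e TE] : exists e, (Q * Q * (T * T) = y + e)%N by exists (Q * Q * (T * T) - y)%N; lia.
  have -> : (y - s = d)%N by lia.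
  have -> : (Q * Q * (T * T) - y = e)%N by lia.
  have [T' T'E] : exists z, T = z.+1 by exists T.-1; lia.
  have -> : (T * T - T = T * T')%N by rewrite T'E; lia.
  have -> : (T - 1 = T')%N by lia.
  have -> : ((Q - 1) * (Q * Q - 1) * (T * T * T) * T' =
             (Q - 1) * T * ((Q * Q - 1) * (T * T) * T'))%N by lia.
  have -> : (d * ((Q - 1) * (T * T)) + e * ((Q - 1) * (T * T')) =
             (Q - 1) * T * (d * T + e * T'))%N by lia.
  rewrite leq_mul2l; apply/orP; right.
  (* With the common factor removed, [d T + e T' = (d + e) T' + d]. Replacing [s + d + e] by
     [q^2 t^2] reduces the claim to [s T' <= d + T^2 T'], which is the hypothesis [crit]. *)
  have k1 : ((Q * Q - 1) * (T * T) * T' + T * T * T' = (s + d + e) * T')%N.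
    by rewrite -yE -TE -mulnDl mulnBl mul1n subnK // leq_pmull //; lia.
  have k2 : (s * T' <= d + T * T * T')%N.
    by move: crit; rewrite yE T'E; lia.
  by move: k1 k2; rewrite !mulnDl {4}T'E; lia.
rewrite [X in (_ <= X)%N](bigID (mem Y)) /=.
rewrite [X in (_ <= X + _)%N](bigID (mem S)) /= -addnA.
apply: leq_trans (leq_addl _ _); apply: leq_add.
  rewrite -sum_nat_const [X in (_ <= X)%N](eq_bigl (fun u => u \in Y :\: S)) => [|u]; last first.
    by rewrite !inE; case: (eta u == 0); rewrite //= andbC.
  by apply: leq_sum => u /light.
rewrite -sum_nat_const [X in (_ <= X)%N](eq_bigl (fun u => u \in Z :\: Y)) => [|u].
  by apply: leq_sum => u /heavy.
by rewrite !inE andbC.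
Qed.
Lemma eigen_sub_light : S \subset Y.
Proof. by apply/subsetP => u uS; rewrite !inE in uS *; case/andP: uS => -> ->. Qed.

Lemma eigenP u : u \in S -> eta u = 0 /\ exists l, u \in eig l.
Proof. by rewrite inE => /andP[/eqP u0 /existsP]. Qed.

Lemma eigen_intro u l : eta u = 0 -> u \in eig l -> u \in S.
Proof. by move=> u0 ul; rewrite inE u0 eqxx; apply/existsP; exists l. Qed.

(** * Sufficient conditions for the counting inequality *)

Definition light_criterion := (#|S| * t + t * t <= #|Y| + t * t * t)%N.

Let t_gt0 : (0 < t)%N. Proof. by rewrite expn_gt0 q_gt0. Qed.
Let q_le_t : (q <= t)%N. Proof. by rewrite -{1}(expn1 q) leq_pexp2l ?q_gt0. Qed.

(** Since [S] is contained in [Y], it is enough that [|S| (t - 1) <= t^2 (t - 1)]. *)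
Lemma criterion_few_eigen : (#|S| <= t * t)%N -> light_criterion.
Proof.
rewrite /light_criterion; have := subset_leq_card eigen_sub_light.
move: #|S| #|Y| t_gt0 => s y; move: t => [//|z] _ sy sT.
have := leq_mul sT (leqnn z); rewrite [(s * z.+1)%N]mulnS [(_ * z.+1 * z.+1)%N]mulnS; lia.
Qed.

Lemma criterion_many_light :
  (#|S| + t <= t * t + q * t)%N -> (q * (t * t) <= #|Y|)%N -> light_criterion.
Proof.
rewrite /light_criterion; move: #|S| #|Y| t_gt0 => s y; move: t => T; move: q => Q; nia.
Qed.

Lemma eigen_le_nsing R : (forall v, v \in S -> v \in R) -> (#|S| <= N0 R)%N.
Proof.
move=> SR; apply: subset_leq_card; apply/subsetP => v vS.
by rewrite inE SR //; have [-> _] := eigenP vS; rewrite eqxx.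
Qed.

(** The inequality is strict because 0 is counted in both subspaces. *)
Lemma eigen_le_nsing2 R L : (forall v, v \in S -> v \in R \/ v \in L) ->
  (#|S| < N0 R + N0 L)%N.
Proof.
move=> SRL; rewrite /nsing; set A := [set v in R | _]; set C := [set v in L | _].
have SAC : (#|S| <= #|A :|: C|)%N.
  apply: subset_leq_card; apply/subsetP => v vS; have [v0 _] := eigenP vS.
  by rewrite !inE v0 eqxx !andbT; apply/orP/SRL.
have AC0 : (0 < #|A :&: C|)%N.
  by apply/card_gt0P; exists 0; rewrite !inE !mem0v eta0 // eqxx.
by rewrite -cardsUI (leq_ltn_trans SAC) // -{1}[#|A :|: C|]addn0 ltn_add2l.
Qed.

(** If all singular vectors of [L] lie in [R], so does [S], and [nsing_codim2] applies. Otherwise a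
    singular [a] of [L] outside [R] shows that [L] is not totally singular. A nonzero [b] in
    [radQ R] would span with [a] a totally singular [L], so [R] has at most [t^2] singular vectors
    and [L] at most [2q - 1]. *)
Lemma rank_two_eigen_bound R : \dim R = (m + m).+1 -> \dim (orth B R) = 2%N ->
    (forall v, v \in S -> v \in R \/ v \in orth B R) ->
    (totsing eta (orth B R) -> (orth B R <= R)%VS) ->
  (#|S| + t <= t * t + q * t)%N.
Proof.
set L := orth B R => dR dL SRL Lts; have LP v : v \in L -> forall u, u \in R -> B u v = 0.
  by move=> /(perpP etaQ).
have [/existsP[a /and3P[aL aR /eqP a0]]|/existsPn noa] :=
    boolP [exists a : V, [&& a \in L, a \notin R & eta a == 0]]; last first.
  rewrite -expnD -expnS; apply: leq_trans (nsing_codim2 etaQ eta_nd dimV dR).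
  rewrite leq_add2r; apply: eigen_le_nsing => v vS; have [//|vL] := SRL v vS.
  by have [v0 _] := eigenP vS; have := noa v; rewrite vL v0 eqxx andbT /= negbK.
have Lns : ~ totsing eta L by move/Lts/subvP/(_ a aL); rewrite (negPf aR).
have rR : radQ eta R = 0%VS.
  apply/eqP; rewrite -subv0; apply/subvP => b /(radQP etaQ)[bR b0 bP]; rewrite memv0.
  have bL : b \in L by apply/(perpP etaQ) => u uR; rewrite polarC bP.
  apply/negPn/negP => bn0; apply: Lns.
  suff -> : L = (<[b]> + <[a]>)%VS.
    apply: totsing_add => //; first by move=> _ /vlineP[k ->]; rewrite etaZ // b0 mulr0.
    by move=> _ /vlineP[k ->]; rewrite polarZl // LP // mulr0.
  apply/eqP; rewrite eq_sym eqEdim subv_add -!memvE aL bL dL.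
  rewrite dim_add_line ?dim_vline ?bn0 //; apply: contra aR => /vlineP[k ->].
  by rewrite memvZ.
have := eigen_le_nsing2 SRL; have := nsing_plane etaQ dL Lns.
have : (N0 R <= t * t)%N.
  have := nsing_odd_dim etaQ _ rR; rewrite dR /= oddD addbb => /(_ isT).
  by rewrite expnS leq_pmul2l ?q_gt0 // expnD.
have := q_gt1 F; move: q_le_t #|S| (N0 R) (N0 L) => + s x y; move: t => T; move: q => Q; nia.
Qed.

Lemma dim_eig_odd l : (forall v, l * B v v = 0) -> odd (\dim (eig l)).
Proof.
move=> lB; have -> := odd_dim_radical (pencil_bilin l) _; first by rewrite dimV /= oddD addbb.
by move=> v; rewrite /pencil beta0 lB subrr.
Qed.

(** The two spaces are the right and the left radical of the same form [pencil l]. *)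
Lemma dim_eig_opp l : \dim (eig (- l)) = \dim (eig l).
Proof.
have := dim_orth_pairing {:V} {:V} (pencil_bilin l); rewrite !capfv => /addnI <-.
congr (\dim _); apply/vspaceP => v.
apply/eigP/(orthP _ _ (pencil_bilin l)) => [h u _|h u].
  by rewrite /pencil (alternatingN betaL beta0 v u) h polarC; ring.
have /subr0_eq := h u (memvf u); rewrite (alternatingN betaL beta0 v u) => /eqP.
by rewrite eqr_oppLR => /eqP->; rewrite polarC mulNr.
Qed.

Hypothesis beta_polar : forall l, exists u v, beta u v != l * B u v.

Lemma dim_eig_lt l : (\dim (eig l) < (m + m).+3)%N.
Proof.
rewrite -dimV ltn_neqAle dimvS ?subvf // andbT; apply/eqP => E.
have /eqP eE : eig l == {:V}%VS by rewrite eqEdim subvf E leqnn.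
have [u [v /eqP uv]] := beta_polar l; apply: uv.
by have /eigP : u \in eig l by rewrite eE memvf.
Qed.

(** * The counting inequality in odd characteristic *)

Section OddCharacteristic.
Hypothesis F2 : (2%:R : F) != 0.

Lemma perp_full_odd : orth B {:V} = 0%VS.
Proof.
apply/eqP; rewrite -subv0; apply/subvP => v vR; rewrite memv0; apply/eqP.
apply: (singular_radical etaQ eta_nd vR); apply: (mulfI F2).
by rewrite mulr0 mulr_natl -polarvv //; move/(perpP etaQ): vR; apply; rewrite memvf.
Qed.

Lemma eig_totsing l : l != 0 -> totsing eta (eig l).
Proof.
move=> l0 v vl; apply: (mulfI F2); rewrite mulr0 mulr_natl -polarvv //.
by apply: (eig_polar vl vl); rewrite -mulr2n -mulr_natl mulf_neq0.
Qed.

(** A singular eigenvector outside [X'] is orthogonal to the maximal totally singular [X], hence in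
    [X]; so [|S| < 2 q t]. Conversely, all sums [x + y] of orthogonal vectors of [X] and [X'] are
    light. *)
Lemma criterion_maximal_eigenspace l : l != 0 -> \dim (eig l) = m.+1 -> light_criterion.
Proof.
move=> l0 dl; have ll : l != - l.
  by rewrite -subr_eq0 opprK -mulr2n -mulr_natl mulf_neq0.
have dl' : \dim (eig (- l)) = m.+1 by rewrite dim_eig_opp.
have Nl0 : - l != 0 by rewrite oppr_eq0.
have ts := eig_totsing l0; have ts' := eig_totsing Nl0.
set X := eig l in dl ts *; set X' := eig (- l) in dl' ts' *.
have S_le : (#|S| < q * t + q * t)%N.
  have : (forall v, v \in S -> v \in X \/ v \in X').
    move=> v vS; have [v0 [k vk]] := eigenP vS.
    have [kE|kl'] := eqVneq k (- l); first by right; rewrite /X' -kE.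
    left; apply/negPn/negP => vX.
    have : totsing eta (X + <[v]>).
      apply: totsing_add => // w wX; apply: (eig_polar wX vk).
      by rewrite addrC addr_eq0.
    by move/(totsing_dim etaQ eta_nd dimV); rewrite dim_add_line // dl ltnn.
  move/eigen_le_nsing2; have NX W : totsing eta W -> \dim W = m.+1 -> N0 W = (q * t)%N.
    move=> Ws dW; rewrite -expnS -dW -card_vs; apply: eq_card => v; rewrite !inE.
    by apply: andb_idr => /Ws ->.
  by rewrite !NX.
have Y_ge : (q * t + (q * t - 1) * t <= #|Y|)%N.
  pose P x y := (y \in X') && (B x y == 0).
  apply: (@leq_trans #|[set p : V * V | (p.1 \in X) && P p.1 p.2]|).
    (* The vector [x = 0] is paired with all [q t] vectors of [X'], each of the other [q t - 1]
       vectors [x] with at least [t]. *)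
    rewrite (card_pairs (mem X) P) (bigD1 0) /=; last exact: mem0v.
    apply: leq_add.
      rewrite -expnS -dl' -card_vs; apply: subset_leq_card; apply/subsetP => y.
      by rewrite !inE /P => ->; rewrite bil0l // eqxx.
    rewrite (_ : (q * t - 1)%N = #|[pred x in X | x != 0]|); last first.
      rewrite -expnS -dl -card_vs (cardsD1 0) inE mem0v addKn.
      by apply: eq_card => x; rewrite !inE andbC.
    rewrite -sum_nat_const; apply: leq_sum => x _.
    apply: (@leq_trans #|[set y in X' :&: kerf (B x)]%VS|); last first.
      by apply: subset_leq_card; apply/subsetP => y; rewrite !inE memv_cap mem_kerf.
    by rewrite card_vs leq_pexp2l ?q_gt0 // -ltnS -dl' dim_kerf_ge.
  rewrite -(card_in_imset (f := fun p : V * V => p.1 + p.2)) => [|[x y] [x' y']].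
    apply: subset_leq_card; apply/subsetP => _ /imsetP[[x y] + ->].
    rewrite inE /= => /and3P[xX yX /eqP xy]; set u := x + y.
    have [x0 y0] := (ts x xX, ts' y yX).
    have u0 : eta u = 0 by rewrite etaD x0 y0 xy !addr0.
    have [/(subsetP eigen_sub_light) //|uS] := boolP (u \in S).
    have [/eigP xl /eigP yl] := (xX, yX).
    have xn0 : x != 0.
      by apply: contraNneq uS => xE; apply: (eigen_intro (l := - l)); rewrite // /u xE add0r.
    have yn0 : y != 0.
      by apply: contraNneq uS => yE; apply: (eigen_intro (l := l)); rewrite // /u yE addr0.
    have Bxx := totsing_polar ts xX xX.
    (* If [w] is orthogonal to [x + y] and to [x], it is orthogonal to [y], and
       [beta (x + y) w = l B x w - l B y w = 0]. *)
    apply: (light_perp (y := x)) => //.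
    - apply/negP => /vlineP[k xE]; have [kE|kn0] := eqVneq k 0.
        by move: xn0; rewrite xE kE scale0r eqxx.
      case/negP: yn0; apply/eqP; apply: (eig_disjoint (l := l) (k := - l)) => //.
      have -> : y = k^-1 *: x - x.
        by rewrite {1}xE scalerA mulVf // scale1r /u addrC addKr.
      by rewrite memvB ?memvZ.
    - by rewrite polarDl // Bxx add0r polarC.
    - by rewrite bilDl // xl yl Bxx polarC xy !mulr0 addr0.
    move=> w; rewrite polarDl // bilDl // xl yl => + xw; rewrite xw add0r => ->.
    by rewrite !mulr0 addr0.
  rewrite !inE /= => /and3P[xX yX _] /and3P[xX' yX' _] E.
  have E' : x - x' = y' - y by apply/eqP; rewrite subr_eq addrAC -subr_eq opprK E addrC.
  have d1 : x - x' \in X by rewrite memvB.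
  have d2 : x - x' \in X' by rewrite E' memvB.
  have xE := eig_disjoint d1 d2 ll (ts _ d1).
  by move: (E'); rewrite xE => /esym/subr0_eq ->; rewrite (subr0_eq xE).
move: S_le Y_ge; rewrite /light_criterion; have := q_gt1 F.
move: #|S| #|Y| q_le_t => s y; move: t => [|z]; move: q => Q; first by rewrite leqn0 => /eqP->.
move=> Qz Q1 sQ; rewrite mulnBl mul1n => Qy.
have h1 := leq_mul sQ (leqnn z.+1).
(* With [t = z + 1], the two estimates reduce the criterion to [(t - q) t (t - 1) >= 0]. *)
have h2 : (z.+1 * (Q * z) <= z.+1 * (z.+1 * z))%N by rewrite leq_mul2l leq_mul2r Qz !orbT.
have h3 : (z.+1 <= Q * z.+1 * z.+1)%N by rewrite leq_pmull // muln_gt0; lia.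
by lia.
Qed.

(** Eigenvectors for nonzero [l] lie in the plane [L]. If [L] is anisotropic, [S] lies in the
    non-degenerate [R]. Otherwise, for a nonzero singular [a] in [L], [beta] vanishes on the
    hyperplane orthogonal to [a], and all [q t^2] singular vectors there are light. *)
Lemma criterion_rank_two_odd : \dim (eig 0) = (m + m).+1 -> light_criterion.
Proof.
move=> dR; set R := eig 0 in dR *; set L := orth B R.
have dL : \dim L = 2%N.
  by have := dim_perp etaQ dimV R; rewrite perp_full_odd capv0 dimv0 dR -/L; lia.
have LP v : v \in L -> forall u, u \in R -> B u v = 0 by move=> /(perpP etaQ).
have SRL v : v \in S -> v \in R \/ v \in L.
  move=> /eigenP[v0 [l vl]]; have [lE|l0] := eqVneq l 0; first by left; rewrite /R -lE.
  right; apply/(perpP etaQ) => u uR; apply: (eig_polar uR vl).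
  by rewrite add0r.
have LL : orth B L = R.
  apply/esym/eqP; rewrite eqEdim; apply/andP; split.
    by apply/subvP => v vR; apply/(perpP etaQ) => u uL; rewrite polarC LP.
  by have := dim_perp etaQ dimV L; rewrite perp_full_odd capv0 dimv0 dR dL; lia.
have [/existsP[a /and3P[aL an0 /eqP a0]]|/existsPn noa] :=
    boolP [exists a : V, [&& a \in L, a != 0 & eta a == 0]]; last first.
  apply: criterion_few_eigen.
  have rR : radQ eta R = 0%VS.
    apply/eqP; rewrite -subv0; apply/subvP => b /(radQP etaQ)[bR b0 bP]; rewrite memv0.
    apply: contraTT isT => bn0; have := noa b; rewrite bn0 b0 eqxx andbT andbT /= => /negP[].
    by apply/(perpP etaQ) => u uR; rewrite polarC bP.
  have := nsing_odd_dim etaQ _ rR; rewrite dR /= oddD addbb => /(_ isT).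
  rewrite expnS leq_pmul2l ?q_gt0 // expnD; apply: leq_trans.
  apply: eigen_le_nsing => v vS; have [//|vL] := SRL v vS; have [v0 _] := eigenP vS.
  by have := noa v; rewrite vL v0 eqxx andbT negbK => /eqP->; rewrite mem0v.
have Baa : B a a = 0 by rewrite polarvv // a0 mul0rn.
have dA := dim_perp_line etaQ eta_nd dimV a0 an0.
apply: criterion_many_light.
  apply: (@rank_two_eigen_bound R) => // Lts; rewrite -/L -LL; apply/subvP => v vL.
  by apply/(perpP etaQ) => u uL; apply: (totsing_polar Lts).
rewrite -expnD -expnS -(nsing_perp_line etaQ eta_nd dimV a0 an0).
have RA : (R <= kerf (B a))%VS.
  by apply/subvP => v vR; rewrite mem_kerf // polarC LP.
have beta_vanishes u v : u \in kerf (B a) -> v \in kerf (B a) -> beta u v = 0.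
  have [z zA zR] : exists2 z, z \in kerf (B a) & z \notin R.
    by apply: exists_notin; rewrite dA dR.
  have AE : kerf (B a) = (R + <[z]>)%VS.
    by apply/esym/eqP; rewrite eqEdim dim_add_line // dA dR leqnn subv_add RA -memvE zA.
  have Rl x y : x \in R -> beta x y = 0 by move=> /eigP ->; rewrite mul0r.
  rewrite AE => /memv_addP[x xR [_ /vlineP[k ->] ->]] /memv_addP[y yR [_ /vlineP[l ->] ->]].
  rewrite bilDl // Rl // add0r bilZl // bilDr // bilZr // beta0 mulr0 addr0.
  by rewrite (alternatingN betaL beta0 y z) Rl // oppr0 mulr0.
apply: subset_leq_card; apply/subsetP => u; rewrite inE => /andP[uA /eqP u0].
have [/(subsetP eigen_sub_light) //|uS] := boolP (u \in S).
have aA : a \in kerf (B a) by rewrite mem_kerf ?Baa.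
apply: (light_perp (y := a)) => //.
(* If [a] were a multiple of [u], everything orthogonal to [u] would be orthogonal to [a], so
   [beta u] would vanish on it and [u] would be an eigenvector. *)
- apply/negP => /vlineP[k aE]; have [v [uv /eqP]] := noneigenP u0 uS; case.
  by apply: beta_vanishes; rewrite // mem_kerf // aE polarZl // uv mulr0.
- by move: uA; rewrite mem_kerf // polarC => /eqP.
- exact: beta_vanishes.
by move=> w uw aw; apply: beta_vanishes; rewrite // mem_kerf ?aw.
Qed.

(** Outside the two special cases, parity gives [dim (eig 0) <= 2m - 1], and the other eigenspaces
    have dimension at most [m]. Hence [|S| <= q^(2m-1) + (q - 1)(t - 1) <= t^2]. *)
Lemma criterion_odd : light_criterion.
Proof.
have [/existsP[l /andP[l0 /eqP dl]]|/existsPn nol] :=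
  boolP [exists l : F, (l != 0) && (\dim (eig l) == m.+1)].
  exact: (criterion_maximal_eigenspace l0 dl).
have [|d0] := eqVneq (\dim (eig 0)) (m + m).+1; first exact: criterion_rank_two_odd.
have d0_odd : odd (\dim (eig 0)) by apply: dim_eig_odd => v; rewrite mul0r.
have d0_le : (\dim (eig 0%R) <= m + m - 1)%N.
  have := odd_double_half (\dim (eig 0)); rewrite d0_odd -addnn => dE.
  by have := dim_eig_lt 0; move/eqP: d0; lia.
have dl l : l != 0 -> (\dim (eig l) <= m)%N.
  move=> l0; have := totsing_dim etaQ eta_nd dimV (eig_totsing l0).
  by rewrite leq_eqVlt ltnS => /orP[] //; have := nol l; rewrite l0 /= => /negPf ->.
apply: criterion_few_eigen.
have S_le : (#|S :\: [set v in eig 0%R]| <= (q - 1) * (t - 1))%N.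
  apply: leq_trans (card_bigcup_le (P := [pred l : F | l != 0])
    (D := fun l => [set v in eig l] :\ 0) _) _ => [v|].
    rewrite !inE => /andP[v0 /andP[ev /existsP[l vl]]]; exists l.
      by apply: contraNneq v0 => <-.
    by rewrite !inE vl andbT; apply: contraNneq v0 => ->; rewrite mem0v.
  rewrite subn1 -(cardC1 (0 : F)) -sum_nat_const; apply: leq_sum => l l0.
  have -> : #|[set v in eig l] :\ 0| = (q ^ \dim (eig l) - 1)%N.
    by rewrite -card_vs (cardsD1 0 [set v in eig l]) inE mem0v addKn.
  by rewrite leq_sub2r // leq_pexp2l ?q_gt0 ?dl.
have S0_le : (#|S :&: [set v in eig 0%R]| <= q ^ (m + m - 1))%N.
  apply: (@leq_trans (q ^ \dim (eig 0%R))); last by rewrite leq_pexp2l ?q_gt0.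
  by rewrite -card_vs subset_leq_card // subsetIr.
rewrite -(cardsID [set v in eig 0] S).
apply: leq_trans (leq_add S0_le S_le) _.
have tE : (t * t = q * q ^ (m + m - 1))%N.
  by rewrite -expnD -expnS; congr (_ ^ _)%N; lia.
have : (t <= q ^ (m + m - 1))%N by rewrite leq_pexp2l ?q_gt0 //; lia.
rewrite tE; have := q_gt1 F; have := t_gt0.
move: (q ^ (m + m - 1))%N => x; move: t => z; move: q => Q; nia.
Qed.
End OddCharacteristic.

(** * The counting inequality in characteristic 2 *)

Section EvenCharacteristic.
Hypothesis F2 : (2%:R : F) = 0.

Let addFF (x : F) : x + x = 0.
Proof. by rewrite -mulr2n -mulr_natl F2 mul0r. Qed.

Let polar_alt v : B v v = 0.
Proof. by rewrite polarvv // mulr2n addFF. Qed.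

Lemma exists_radical : exists r, eta r != 0 /\ forall w, B r w = 0.
Proof.
have := odd_dim_radical BL polar_alt; rewrite dimV /= oddD addbb /= => dR.
have [|r rR r0] := @exists_nonzero _ _ (orth (flip B) {:V}).
  by case: (\dim _) dR.
have rB w : B r w = 0 by move/(orthP _ _ (flip_bilin BL)): rR; apply; rewrite memvf.
by exists r; split=> //; apply: contraNneq r0 => e0; apply/eqP/eta_nd.
Qed.

Section Radical.
Variable r : V.
Hypotheses (er : eta r != 0) (rB : forall w, B r w = 0).

Let Br w : B w r = 0. Proof. by rewrite polarC rB. Qed.

Lemma radical_line v : v \in orth B {:V} -> v \in <[r]>%VS.
Proof.
move=> vR; have [x xE] := square_root_char2 (eta v / eta r) F2.
have rR : r \in orth B {:V} by apply/(perpP etaQ) => w _.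
apply/vlineP; exists x; apply/subr0_eq/(singular_radical etaQ eta_nd).
  by rewrite memvB // memvZ.
by rewrite -scaleNr etaD etaZ // polarZr // Br sqrrN xE mulfVK // mulr0 addr0.
Qed.

(** As [eta (w + x r) = eta w + x^2 eta r] and square roots exist and are unique, each coset of the
    line of [r] contains exactly one singular vector. *)
Lemma nsing_radical U : r \in U -> (q * N0 U = q ^ \dim U)%N.
Proof.
move=> rU; rewrite -card_vs -cardsT mulnC -cardsX.
have etaE w (x : F) : eta (w + x *: r) = eta w + x ^+ 2 * eta r.
  by rewrite etaD etaZ // polarZr // Br mulr0 addr0.
rewrite -(card_in_imset (f := fun p : V * F => p.1 + p.2 *: r)) => [|[w x] [w' x']].
  apply: eq_card => v; rewrite inE; apply/imsetP/idP => [[[w x] + ->]|vU].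
    by rewrite !inE => /andP[/andP[wU _] _]; rewrite memvD // memvZ.
  have [x xE] := square_root_char2 (eta v / eta r) F2.
  exists (v - x *: r, x); last by rewrite /= subrK.
  by rewrite !inE /= memvB ?memvZ //= -scaleNr etaE sqrrN xE mulfVK // addFF eqxx.
rewrite !inE /= !andbT => /andP[_ /eqP w0] /andP[_ /eqP w0'] E.
have xx' : x = x'.
  have /eqP : x ^+ 2 * eta r = x' ^+ 2 * eta r.
    by have := congr1 eta E; rewrite !etaE w0 w0' !add0r.
  rewrite (inj_eq (mulIf er)) eqf_sqr => /orP[/eqP //|/eqP->].
  by apply/eqP; rewrite eq_sym -addr_eq0 addFF.
by move: E; rewrite xx' => /addIr ->.
Qed.

Lemma radical_notin_line u : eta u = 0 -> r \notin <[u]>%VS.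
Proof.
by move=> u0; apply: contra er => /vlineP[k ->]; rewrite etaZ // u0 mulr0.
Qed.

(** Then [r] lies in [residue u], is orthogonal to all of it, and is not a multiple of [u]. *)
Lemma light_if_radical u : eta u = 0 -> beta r u = 0 -> u \in Y.
Proof.
move=> u0 ru; have [/(subsetP eigen_sub_light) //|uS] := boolP (u \in S).
apply: (light_radical (y := r) u0 uS _ (radical_notin_line u0)) => [|w _]; last exact: rB.
by rewrite mem_residue Br (alternatingN betaL beta0 r u) ru oppr0 eqxx.
Qed.

Lemma eig_perp_even l k u v : l != k -> u \in eig l -> v \in eig k -> B u v = 0.
Proof.
move=> lk ul vk; apply: (eig_polar ul vk); apply: contra lk => /eqP E.
by apply/eqP/(addIr k); rewrite E addFF.
Qed.

Lemma eigen_sub_perp l v : v \in S -> v \in eig l \/ v \in orth B (eig l).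
Proof.
move=> /eigenP[v0 [k vk]]; have [<-|lk] := eqVneq k l; first by left.
by right; apply/(perpP etaQ) => u ul; apply: (eig_perp_even _ ul vk); rewrite eq_sym.
Qed.

Lemma nsing_radical_exp U d : r \in U -> \dim U = d.+1 -> N0 U = (q ^ d)%N.
Proof.
move=> rU dU; have := nsing_radical rU; rewrite dU expnS => /eqP.
by rewrite eqn_pmul2l ?q_gt0 // => /eqP.
Qed.

Lemma criterion_small_eigenspaces : (forall l, \dim (eig l) <= 1)%N -> light_criterion.
Proof.
move=> dl; apply: criterion_few_eigen; have q1 := q_gt1 F.
apply: (@leq_trans (q * q)%N); last by rewrite leq_mul.
have : (#|S :\ 0%R| <= q * (q - 1))%N.
  apply: leq_trans (card_bigcup_le (P := predT) (D := fun l => [set v in eig l] :\ 0) _) _.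
    move=> v; rewrite !inE => /andP[v0 /andP[ev /existsP[l vl]]]; exists l => //.
    by rewrite !inE vl v0.
  rewrite -sum_nat_const; apply: leq_sum => l _.
  have -> : #|[set v in eig l] :\ 0| = (q ^ \dim (eig l) - 1)%N.
    by rewrite -card_vs (cardsD1 0 [set v in eig l]) inE mem0v addKn.
  by rewrite leq_sub2r // -{2}(expn1 q) leq_pexp2l ?q_gt0 ?dl.
rewrite (cardsD1 0 S) zero_eigen; move: #|_ :\ _| => s; move: q q1 => Q; nia.
Qed.

(** Take an eigenspace [R] of maximal dimension [2k + 1]. Distinct eigenspaces are orthogonal, so
    [S] lies in the union of [R] and its orthogonal [L]. The cases depend on [k] and on whether the
    radical vector [r] belongs to [R]. *)
Lemma criterion_even : light_criterion.
Proof.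
have q1 := q_gt1 F.
have [l0 _ lmax] := @arg_maxnP _ (0 : F) predT (fun l => \dim (eig l)) isT.
set R := eig l0; set L := orth B R.
have dR_odd : odd (\dim R) by apply: dim_eig_odd => v; rewrite polar_alt mulr0.
have [k dR] : exists k : nat, \dim R = (k + k).+1.
  by exists (\dim R)./2; have := odd_double_half (\dim R); rewrite dR_odd -addnn.
have [k0|k_gt0] := posnP k.
  by apply: criterion_small_eigenspaces => l; have := lmax l isT; rewrite -/R dR k0.
have k_le : (k <= m)%N by have := dim_eig_lt l0; rewrite -/R dR; lia.
have SRL v : v \in S -> v \in R \/ v \in L by apply: eigen_sub_perp.
have rL : r \in L by apply/(perpP etaQ).
have dL := dim_perp etaQ dimV R; rewrite -/L in dL.
have [rR|rnR] := boolP (r \in R).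
  have rad : (R :&: orth B {:V} = <[r]>)%VS.
    apply/eqP; rewrite eqEsubv subv_cap -memvE rR /= -memvE; apply/andP; split.
      by apply/subvP => v; rewrite memv_cap => /andP[_ /radical_line].
    by apply/(perpP etaQ).
  have rn0 : r != 0 by apply: contraNneq er => ->; rewrite eta0.
  have dL' : \dim L = (m + m - (k + k)).+3 by move: dL; rewrite rad dim_vline rn0 dR; lia.
  have := eigen_le_nsing2 SRL.
  rewrite (nsing_radical_exp rR dR) (nsing_radical_exp rL dL').
  have [i kE] : exists i, (k + k = i.+2)%N by exists (k + k - 2)%N; lia.
  have [j jE] : exists j, (m + m = i.+2 + j)%N by exists (m + m - (k + k))%N; lia.
  have -> : (m + m - (k + k) = j)%N by lia.
  rewrite kE => S_lt.
  (* Since [beta r] is a multiple of [B r], which is zero, every singular vector is light. *)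
  have Y_ge : (q * q * (t * t) <= #|Y|)%N.
    rewrite -expnD -mulnA -!expnS -(nsing_full etaQ eta_nd dimV).
    apply: subset_leq_card; apply/subsetP => u; rewrite inE => /andP[_ /eqP u0].
    apply: light_if_radical => //; move/eigP: rR => ->.
    by rewrite rB mulr0.
  have tt : (t * t = q * q * (q ^ i * q ^ j))%N.
    by rewrite -!expnD -mulnA -!expnS; congr (_ ^ _)%N; lia.
  have x0 : (0 < q ^ i)%N by rewrite expn_gt0 q_gt0.
  have y0 : (0 < q ^ j)%N by rewrite expn_gt0 q_gt0.
  (* With [x = q^i] and [y = q^j] this rests on [x + y <= x y + 1]. *)
  have S_lt' : (#|S| < t * t + q * q)%N.
    apply: leq_trans S_lt _; rewrite tt !expnS; move: (q ^ i)%N (q ^ j)%N x0 y0.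
    move: q => Q [|x] [|y] // _ _; nia.
  rewrite /light_criterion; move: #|S| #|Y| S_lt' Y_ge t_gt0 => s y.
  move: t => [|z]; move: q q1 => Q Q1 // sQ Qy _.
  have h1 := leq_mul sQ (leqnn z.+1).
  have h2 : (z.+1 * z <= Q * Q * (z.+1 * z))%N by rewrite leq_pmull // muln_gt0; lia.
  by lia.
have rad : (R :&: orth B {:V} = 0)%VS.
  apply/eqP; rewrite -subv0; apply/subvP => v; rewrite memv_cap memv0.
  move=> /andP[vR /radical_line/vlineP[x vE]]; rewrite vE.
  have [->|x0] := eqVneq x 0; first by rewrite scale0r.
  case/negP: rnR; have -> : r = x^-1 *: v by rewrite vE scalerA mulVf // scale1r.
  by rewrite memvZ.
have dL' : \dim L = (m + m - (k + k)).+2 by move: dL; rewrite rad dimv0 dR; lia.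
(* If [k = m], the singular vectors of the hyperplane [kerf (beta r)] are light and
   [rank_two_eigen_bound] applies; [L] is not totally singular since it contains [r]. If [k < m],
   both [R] and [L] have at most [q^(2m-1)] singular vectors. *)
have [km|km] := eqVneq k m.
  apply: criterion_many_light.
    apply: (@rank_two_eigen_bound R) => //; rewrite ?dR ?km //.
      by rewrite -/L dL' km subnn.
    by move=> /(_ r rL) e0; move: er; rewrite e0 eqxx.
  have [w rw] : exists w, beta r w != 0.
    apply/existsP; apply: contraNT rnR => /existsPn h; apply/eigP => w.
    by rewrite rB mulr0; apply/eqP/negPn/h.
  have dK := dim_kerf (betal r) (memvf w) rw; rewrite capfv dimV in dK.
  have rK : r \in kerf (beta r) by rewrite mem_kerf ?beta0.
  rewrite -expnD -expnS -(nsing_radical_exp rK); last by case: dK.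
  apply: subset_leq_card; apply/subsetP => u; rewrite inE mem_kerf //.
  by move=> /andP[/eqP ru /eqP u0]; apply: light_if_radical.
apply: criterion_few_eigen; apply: leq_trans (ltnW (eigen_le_nsing2 SRL)) _.
rewrite (nsing_radical_exp rL dL').
have [j mE] : exists j, (m + m = j.+1)%N by exists (m + m).-1; lia.
apply: (@leq_trans (q ^ j + q ^ j)%N); last first.
  by rewrite -expnD mE expnS addnn -mul2n leq_mul2r q1 orbT.
apply: leq_add; last by rewrite leq_pexp2l ?q_gt0 //; lia.
apply: (@leq_trans (q ^ \dim R)).
  by rewrite -card_vs; apply: subset_leq_card; apply/subsetP => v; rewrite !inE => /andP[].
by rewrite dR leq_pexp2l ?q_gt0 //; move/eqP: km; lia.
Qed.
End Radical.
End EvenCharacteristic.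

Lemma light_criterion_holds : light_criterion.
Proof.
have [F2|F2] := eqVneq (2%:R : F) 0; last exact: criterion_odd.
have [r [er rB]] := exists_radical F2; exact: (criterion_even F2 er rB).
Qed.

Theorem weight_pairs_lower_bound :
  ((q - 1) * (q * q - 1) * (t * t * t) * (t - 1) <= #|weight_pairs|)%N.
Proof. exact: weight_pairs_ge light_criterion_holds. Qed.
End Weights.

(** * Singular lines and a word of minimum weight *)

Section Lines.
Variables (F : finFieldType) (V0 : vectType F).
Local Notation V := (finvect_type V0).
Local Notation q := #|F|.
Implicit Types (U W : {vspace V}) (u v w x y : V) (p : V * V).

Definition pair_span p : {vspace V} := (<[p.1]> + <[p.2]>)%VS.

Lemma pair_span_basis U p : \dim U = 2%N ->
  (pair_span p == U) = [&& p.1 \in U, p.1 != 0, p.2 \in U & p.2 \notin <[p.1]>%VS].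
Proof.
case: p => u v; rewrite /pair_span /= => dU; apply/eqP/and4P => [UE|[uU u0 vU vu]].
  have dE := dU; rewrite -UE in dE; split.
  - by rewrite -UE -[X in X \in _]addr0 memv_add ?memv_line ?mem0v.
  - by apply: contra_eqN dE => /eqP->; rewrite add0v dim_vline; case: (v != 0).
  - by rewrite -UE -[X in X \in _]add0r memv_add ?memv_line ?mem0v.
  apply: contra_eqN dE => vu; rewrite (addv_idPl _) -?memvE // dim_vline.
  by case: (u != 0).
by apply/eqP; rewrite eqEdim subv_add -!memvE uU vU dU dim_add_line // dim_vline u0.
Qed.

Lemma card_bases U : \dim U = 2%N ->
  #|[set p | pair_span p == U]| = ((q * q - 1) * (q * q - q))%N.
Proof.
move=> dU; pose A u := (u \in U) && (u != 0); pose P u v := (v \in U) && (v \notin <[u]>%VS).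
transitivity #|[set p : V * V | A p.1 && P p.1 p.2]|.
  by apply: eq_card => p; rewrite !inE pair_span_basis // /A /P andbA.
have qq : (q * q = #|[set v in U]|)%N by rewrite card_vs dU expnS expn1.
rewrite card_pairs (eq_bigr (fun=> (q * q - q)%N)) => [|u /andP[uU u0]].
  rewrite sum_nat_const; congr (_ * _)%N; rewrite qq (cardsD1 0) inE mem0v addKn.
  by apply: eq_card => u; rewrite !inE andbC.
have d1 : \dim <[u]> = 1%N by rewrite dim_vline u0.
rewrite qq -[X in (_ - X)%N]expn1 -d1 -card_vs.
rewrite -cardsDS; first by apply: eq_card => v; rewrite !inE andbC.
by apply/subsetP => v; rewrite !inE => /vlineP[k ->]; rewrite memvZ.
Qed.

Variable eta : V -> F.
Hypothesis etaQ : is_quadratic_form eta.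
Local Notation B := (polar eta).
Local Notation N0 := (nsing eta).

Lemma singular_lineP U :
  reflect (\dim U = 2%N /\ totsing eta U) (U \in singular_lines eta).
Proof.
rewrite inE; apply: (iffP andP) => -[dU Us]; split.
- exact/eqP.
- by move=> v vU; move/totally_singularP: Us; apply.
- exact/eqP.
by apply/totally_singularP => v vU; apply: Us.
Qed.

(** The fibre of [pair_span] over a line of [L] consists of its ordered bases. *)
Lemma card_pairs_lines (A : {set V * V}) (L : {set {vspace V}}) :
    L \subset singular_lines eta ->
    (forall p, (p \in A) = (pair_span p \in L)) ->
  #|A| = (#|L| * ((q * q - 1) * (q * q - q)))%N.
Proof.
move=> Lsing AL; rewrite (card_fibers A pair_span) (bigID (mem L)) /=.
rewrite [X in (_ + X)%N]big1 => [|U UL]; last first.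
  apply/eqP; rewrite cards_eq0; apply/eqP/setP => p; rewrite !inE AL.
  by apply/negP => /andP[+ /eqP pU]; rewrite pU (negPf UL).
rewrite addn0 -sum_nat_const; apply: eq_bigr => U UL.
have /singular_lineP[dU _] := subsetP Lsing U UL.
rewrite -(card_bases dU); apply: eq_card => p; rewrite !inE AL.
by apply: andb_idl => /eqP ->.
Qed.

Lemma pair_span_singular p : eta p.1 = 0 -> eta p.2 = 0 -> B p.1 p.2 = 0 ->
  totsing eta (pair_span p).
Proof.
move=> u0 v0 uv; apply: totsing_add => //.
  by move=> _ /vlineP[k ->]; rewrite etaZ // u0 mulr0.
by move=> _ /vlineP[k ->]; rewrite polarZl // uv mulr0.
Qed.

Lemma mem_pair_span p : p.1 \in pair_span p /\ p.2 \in pair_span p.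
Proof.
by split; [rewrite -[X in X \in _]addr0|rewrite -[X in X \in _]add0r]; rewrite memv_add ?memv_line ?mem0v.
Qed.

Lemma pair_span_line p : p.1 != 0 -> p.2 \notin <[p.1]>%VS ->
    eta p.1 = 0 -> eta p.2 = 0 -> B p.1 p.2 = 0 ->
  pair_span p \in singular_lines eta.
Proof.
move=> u0 vu eu ev uv; apply/singular_lineP; split; last exact: pair_span_singular.
by rewrite dim_add_line // dim_vline u0.
Qed.

Section Form.
Variable beta : V -> V -> F.
Hypothesis betaL : bilin beta.
Hypothesis beta0 : forall v, beta v v = 0.

Definition nonisotropic_lines : {set {vspace V}} :=
  [set U in singular_lines eta |
     [exists u : V, exists v : V, [&& u \in U, v \in U & beta u v != 0]]].

Lemma nonisotropic_independent u v : beta u v != 0 -> (u != 0) && (v \notin <[u]>%VS).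
Proof.
move=> uv; apply/andP; split; first by apply: contraNneq uv => ->; rewrite bil0l.
by apply: contra uv => /vlineP[k ->]; rewrite bilZr // beta0 mulr0.
Qed.

Lemma nonisotropicP U : reflect
  (U \in singular_lines eta /\ exists u v, [/\ u \in U, v \in U & beta u v != 0])
  (U \in nonisotropic_lines).
Proof.
rewrite [U \in nonisotropic_lines]in_set; apply: (iffP andP) => -[-> h]; split=> //.
  by case/existsP: h => u /existsP[v /and3P[uU vU uv]]; exists u, v.
by case: h => u [v [uU vU uv]]; apply/existsP; exists u; apply/existsP; exists v; apply/and3P.
Qed.

Lemma nonisotropic_span U u v : U \in singular_lines eta -> u \in U -> v \in U ->
  beta u v != 0 -> pair_span (u, v) = U.
Proof.
move=> /singular_lineP[dU _] uU vU /nonisotropic_independent/andP[u0 vu].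
by apply/eqP; rewrite pair_span_basis //= uU vU u0.
Qed.

Lemma nonisotropic_pair_span p :
  (pair_span p \in nonisotropic_lines) =
  [&& eta p.1 == 0, eta p.2 == 0, B p.1 p.2 == 0 & beta p.1 p.2 != 0].
Proof.
have [u1 u2] := mem_pair_span p.
apply/nonisotropicP/and4P => [[/singular_lineP[dU Us] [x [y [xU yU xy]]]]|[/eqP e1 /eqP e2 /eqP e12 b12]].
  split; rewrite ?Us ?(totsing_polar Us) //.
  apply: contra xy => /eqP b12; have b21 := alternating_perp betaL beta0 b12.
  case/memv_addP: xU => _ /vlineP[a ->] [_ /vlineP[b ->] ->].
  case/memv_addP: yU => _ /vlineP[c ->] [_ /vlineP[d ->] ->].
  by rewrite bilDr // !bilDl // !bilZl // !bilZr // b12 b21 !beta0 !mulr0 !addr0.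
have /andP[p1 p2] := nonisotropic_independent b12.
by split; [exact: pair_span_line | exists p.1, p.2].
Qed.

Lemma card_nonisotropic_lines :
  #|weight_pairs eta beta| = (#|nonisotropic_lines| * ((q * q - 1) * (q * q - q)))%N.
Proof.
apply: card_pairs_lines => [|p]; first by apply/subsetP => U /nonisotropicP[].
by rewrite nonisotropic_pair_span inE.
Qed.
End Form.

(** * The number of singular lines and the extremal form *)

Hypothesis eta_nd : nondegenerate_quadratic_form eta.
Variable m : nat.
Hypothesis dimV : \dim {:V} = (m + m).+3.
Local Notation t := (q ^ m)%N.
Let BL := polar_bilin etaQ.
Let Bl u : scalar (B u). Proof. by case: BL. Qed.

(** Ordered bases are counted: first a nonzero singular [u], then a singular vector orthogonal to
    [u] and outside its line. *)
Lemma card_singular_lines :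
  (#|singular_lines eta| * ((q * q - 1) * (q * q - q)) =
   (q ^ (m + m).+2 - 1) * (q ^ (m + m).+1 - q))%N.
Proof.
pose A u := (eta u == 0) && (u != 0).
pose P u v := [&& eta v == 0, B u v == 0 & v \notin <[u]>%VS].
rewrite -(@card_pairs_lines [set p : V * V | A p.1 && P p.1 p.2]) // => [|p].
  rewrite card_pairs (eq_bigr (fun=> (q ^ (m + m).+1 - q)%N)) => [|u /andP[/eqP u0 un0]].
    rewrite sum_nat_const; congr (_ * _)%N.
    rewrite -(nsing_full etaQ eta_nd dimV) /nsing (cardsD1 0) inE mem0v eta0 // eqxx addKn.
    by apply: eq_card => u; rewrite !inE memvf andbC.
  rewrite -(nsing_perp_line etaQ eta_nd dimV u0 un0) /nsing.
  have d1 : \dim <[u]> = 1%N by rewrite dim_vline un0.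
  rewrite -[X in (_ - X)%N]expn1 -d1 -card_vs.
  rewrite -cardsDS.
    by apply: eq_card => v; rewrite !inE mem_kerf // /P; case: (v \in _); rewrite ?andbF ?andbT //= andbC.
  apply/subsetP => v; rewrite !inE => /vlineP[k ->].
  by rewrite mem_kerf // polarZr // polarvv // etaZ // u0 mul0rn !mulr0 eqxx.
rewrite !inE /A /P; have [u1 u2] := mem_pair_span p.
apply/idP/idP => [/andP[/andP[/eqP e1 p1] /and3P[/eqP e2 /eqP e12 p2]]|].
  by have := pair_span_line p1 p2 e1 e2 e12; rewrite inE.
move=> h; have /singular_lineP[dU Us] : pair_span p \in singular_lines eta by rewrite inE.
have := pair_span_basis p dU; rewrite eqxx => /esym/and4P[_ -> _ ->].
by rewrite !Us // (totsing_polar Us) // eqxx.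
Qed.

Lemma scaled_fiber (f : V -> F) U c : scalar f -> c != 0 ->
  #|[set v in U | (eta v == 0) && (f v == c)]| =
  #|[set v in U | (eta v == 0) && (f v == 1)]|.
Proof.
move=> fL c0; rewrite -(card_imset [set v in U | (eta v == 0) && (f v == 1)] (scalerI c0)).
apply: eq_card => v; rewrite inE; apply/idP/imsetP => [/and3P[vU /eqP v0 /eqP fv]|[w + ->]].
  exists (c^-1 *: v); last by rewrite scalerA mulfV // scale1r.
  by rewrite inE memvZ // etaZ // v0 mulr0 linZ // fv mulVf // !eqxx.
by rewrite inE => /and3P[wU /eqP w0 /eqP fw]; rewrite memvZ // etaZ // w0 mulr0 linZ // fw mulr1 !eqxx.
Qed.

Lemma nsing_hyperplane_fibers (f : V -> F) U : scalar f ->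
  (N0 U = N0 (U :&: kerf f)%VS + (q - 1) * #|[set v in U | (eta v == 0%R) && (f v == 1%R)]|)%N.
Proof.
move=> fL; rewrite {1}/nsing (card_fibers _ f) (bigD1 0) //=; congr (_ + _)%N.
  by apply: eq_card => v; rewrite !inE memv_cap mem_kerf // andbAC.
rewrite subn1 -(cardC1 (0 : F)) -sum_nat_const; apply: eq_bigr => c c0.
by rewrite -(scaled_fiber U fL c0); apply: eq_card => v; rewrite !inE andbA.
Qed.

(* [e, f] is a hyperbolic pair with orthogonal complement [V'], and [g] is a
   functional vanishing on [e], [f] and on a hyperbolic hyperplane of [V']; the
   form is [B(f, -) /\ g]. *)
Lemma exists_extremal_form : exists beta : V -> V -> F,
  [/\ bilin beta, forall v, beta v v = 0 &
      (q * #|nonisotropic_lines beta| = t * t * t * (t - 1))%N].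
Proof.
have q1 := q_gt1 F; have q0 := q_gt0 F.
have [e e0 ee] : exists2 e : V, e != 0 & eta e = 0.
  have [|v [vV v0 ev]] := three_dim_isotropic etaQ (U := {:V}); first by rewrite dimV.
  by exists v.
have [v ev] := exists_nonperp eta_nd ee e0.
have [f _ ef] := hyperbolic_partner etaQ (memvf e) (memvf v) ee ev.
have [_ f0 Bef] := ef; have Bfe : B f e = 1 by rewrite polarC.
have Bee : B e e = 0 by rewrite polarvv // ee mul0rn.
have Bff : B f f = 0 by rewrite polarvv // f0 mul0rn.
pose V' := ({:V} :&: kerf (B e) :&: kerf (B f))%VS.
have VE : {:V}%VS = (V' + <[e]> + <[f]>)%VS.
  exact: (hyperbolic_decomposition etaQ ef (memvf e) (memvf f)).
have V'P w : reflect (B e w = 0 /\ B f w = 0) (w \in V').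
  by rewrite !memv_cap memvf !mem_kerf //; apply: (iffP andP) => -[/eqP ? /eqP].
have eV' w : w \in V' -> B e w = 0 by case/V'P.
have fV' w : w \in V' -> B f w = 0 by case/V'P.
have dV' : \dim V' = (m + m).+1.
  by have := dim_split etaQ ef eV' fV'; rewrite -VE dimV => -[].
have radV' : radQ eta V' = 0%VS.
  apply/eqP; rewrite -subv0; apply/subvP => z /(radQP etaQ)[zV' z0 zP]; rewrite memv0.
  apply/eqP/eta_nd => // w; have := memvf w; rewrite VE.
  move=> /memv_addP[_ /memv_addP[x xV' [_ /vlineP[a ->] ->]] [_ /vlineP[b ->] ->]].
  rewrite !polarDr // !polarZr // zP // !(polarC _ z) eV' // fV' //.
  by rewrite !mulr0 !addr0.
(* Since [dim V' = 2m + 1] and [r = 0], we get [k = m], and the hyperbolic part [K] is a hyperplane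
   of [V']. *)
have [k [r [a [[dW a2 rW] cN _ _ [K [KV' dK cK]]]]]] := witt_decomposition etaQ V'.
rewrite radV' dimv0 in rW; have km : k = m by lia.
rewrite {}km -{}rW dV' in dW dK cK cN; rewrite addn0 in cN.
have N0V' : (q * N0 V' = q ^ (m + m).+1)%N.
  have E : ((m + m).+1 - m = m.+1)%N by lia.
  by move: cN; rewrite E => /addIn.
have KP w : w \in K -> w \in V' by apply: subvP.
have [x _ xW] : exists2 x, x \in {:V}%VS & x \notin (K + <[e]> + <[f]>)%VS.
  apply: exists_notin; have eK w : w \in K -> B e w = 0 by move/KP/eV'.
  have fK w : w \in K -> B f w = 0 by move/KP/fV'.
  by rewrite (dim_split etaQ ef eK fK) dK dimV.
have [g [gL gx gW]] := exists_functional xW.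
have gK w : w \in K -> g w = 0.
  by move=> wK; apply: gW; rewrite -addvA; apply: subvP (addvSl _ _) _ wK.
have ge : g e = 0 by apply: gW; apply: subvP (addvSl _ _) _ _; apply: subvP (addvSr _ _) _ (memv_line e).
have gf : g f = 0 by apply: gW; apply: subvP (addvSr _ _) _ (memv_line f).
have KE : (V' :&: kerf g)%VS = K.
  apply/esym/eqP; rewrite eqEdim subv_cap KV'; apply/andP; split.
    by apply/subvP => w wK; rewrite mem_kerf // gK.
  have [y yV' gy] : exists2 y, y \in V' & g y != 0.
    have := memvf x; rewrite VE.
    move=> /memv_addP[_ /memv_addP[y yV' [_ /vlineP[b ->] ->]] [_ /vlineP[c ->] xE]].
    exists y => //; move: gx; rewrite xE !linD // !linZ // ge gf !mulr0 !addr0 => ->.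
    exact: oner_neq0.
  by have := dim_kerf gL yV' gy; rewrite dV' dK => -[->].
pose M := #|[set w in V' | (eta w == 0) && (g w == 1)]|.
(* The singular vectors of [V'] outside [K] are spread evenly over the [q - 1] nonzero values of
   [g]. *)
have ME : (q * M = t * (t - 1))%N.
  have := nsing_hyperplane_fibers V' gL; rewrite KE -/M.
  move: cK N0V'; rewrite !expnS expnD; move: (N0 V') (N0 K) M => N1 N2 M'.
  move: t => T; move: q q1 => Q Q1 h1 h2 h3; apply/eqP.
  have Q1' : (0 < Q - 1)%N by rewrite subn_gt0.
  rewrite -(eqn_pmul2l Q1') mulnBr muln1; apply/eqP; rewrite h3 mulnDr in h2.
  have [d dE] : exists d, (T * T = T + d)%N.
    by exists (T * T - T)%N; rewrite subnKC //; case: (T) => // z; rewrite leq_pmulr.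
  rewrite dE addKn; rewrite dE in h1 h2; case: Q Q1 {Q1' h3} h1 h2 => // R _.
  by rewrite subn1 /= !mulSn mulnDr; lia.
pose beta u v := B f u * g v - B f v * g u.
have betaL : bilin beta.
  split=> u b v1 v2; rewrite /beta.
    by rewrite polarDr // polarZr // gL; ring.
  by rewrite polarDr // polarZr // gL; ring.
have beta0 u : beta u u = 0 by rewrite /beta subrr.
exists beta; split=> //.
(* [beta u v] is the determinant of the functionals [B f] and [g] on [(u, v)], so each line counted
   has exactly one basis dual to them; [A] collects these bases. *)
pose A := [set p : V * V | [&& eta p.1 == 0, eta p.2 == 0 & B p.1 p.2 == 0] &&
                           [&& B f p.1 == 1, g p.1 == 0, B f p.2 == 0 & g p.2 == 1]].
have AP p : reflect ([/\ eta p.1 = 0, eta p.2 = 0 & B p.1 p.2 = 0] /\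
    [/\ B f p.1 = 1, g p.1 = 0, B f p.2 = 0 & g p.2 = 1]) (p \in A).
  rewrite inE; apply: (iffP andP) => -[].
    by move=> /and3P[/eqP ? /eqP ? /eqP ?] /and4P[/eqP ? /eqP ? /eqP ? /eqP ?].
  by move=> [-> -> ->] [-> -> -> ->]; rewrite !eqxx.
have -> : #|nonisotropic_lines beta| = #|A|.
  have injA : {in A &, injective pair_span}.
    move=> [u1 v1] [u2 v2] /AP/= [_ [fu1 gu1 fv1 gv1]] /AP/= [_ [fu2 gu2 fv2 gv2]] E.
    have [] := mem_pair_span (u2, v2); rewrite -E /= => uU vU.
    have coords w : w \in pair_span (u1, v1) -> w = B f w *: u1 + g w *: v1.
      move=> /memv_addP[_ /vlineP[b ->] [_ /vlineP[c ->] ->]].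
      rewrite polarDr // !polarZr // linD // !linZ // fu1 fv1 gu1 gv1.
      by rewrite !mulr0 !mulr1 addr0 add0r.
    by rewrite (coords _ uU) (coords _ vU) fu2 fv2 gu2 gv2 !scale1r !scale0r addr0 add0r.
  rewrite -(card_in_imset injA); apply: eq_card => U.
  apply/(nonisotropicP)/imsetP => [[Ul [u [v1 [uU vU uv]]]]|[p /AP[[p1 p2 p12] [fp1 gp1 fp2 gp2]] ->]].
    have [dU Us] := singular_lineP U Ul.
    pose p := ((beta u v1)^-1 *: (g v1 *: u - g u *: v1),
               (beta u v1)^-1 *: (B f u *: v1 - B f v1 *: u)).
    have [pU1 pU2] : p.1 \in U /\ p.2 \in U by rewrite !memvZ ?memvB ?memvZ.
    have pA : p \in A.
      apply/AP; split.
        by rewrite !Us // (totsing_polar Us).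
      rewrite /= !polarZr // !linZ // -!scaleNr !polarDr // !linD // !polarZr // !linZ //.
      by move: uv; rewrite /beta => uv; split; field.
    exists p => //; apply/esym; rewrite [p]surjective_pairing.
    apply: (nonisotropic_span betaL beta0 Ul pU1 pU2).
    by move/AP: pA => [_ [fp1 gp1 fp2 gp2]]; rewrite /beta fp1 gp1 fp2 gp2 mul0r subr0 mulr1 oner_neq0.
  apply/nonisotropicP; rewrite nonisotropic_pair_span // p1 p2 p12 eqxx /=.
  by rewrite /beta fp1 gp1 fp2 gp2 mul0r subr0 mulr1 oner_neq0.
have -> : #|A| = (q ^ (m + m) * M)%N.
  rewrite -dK -card_vs -cardsX.
  (* A pair of [A] is determined by its components [w1] in [K] and [w2] in [V']: the coefficients of
     [e] are prescribed, and those of [f] are forced by singularity of the first vector and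
     orthogonality. *)
  pose h (p : V * V) := (p.1 + 1 *: e + (- eta p.1) *: f, p.2 + 0 *: e + (- B p.1 p.2) *: f).
  have Bf w b c : w \in V' -> B f (w + b *: e + c *: f) = b.
    by move=> wV'; rewrite !polarDr // !polarZr // fV' // Bfe Bff; ring.
  have Be w b c : w \in V' -> B e (w + b *: e + c *: f) = c.
    by move=> wV'; rewrite !polarDr // !polarZr // eV' // Bef Bee; ring.
  have gE w b c : g (w + b *: e + c *: f) = g w.
    by rewrite !linD // !linZ // ge gf !mulr0 !addr0.
  have BE w1 w2 b1 b2 c1 c2 : w1 \in V' -> w2 \in V' ->
      B (w1 + b1 *: e + c1 *: f) (w2 + b2 *: e + c2 *: f) = B w1 w2 + b1 * c2 + c1 * b2.
    move=> w1V' w2V'; rewrite polarDl // polarZl // Bf // polarDl // polarZl // Be //.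
    by rewrite !polarDr // !polarZr // !(polarC _ w1) eV' // fV' //; ring.
  rewrite -[RHS](card_in_imset (f := h)) => [|[w1 w2] [z1 z2]].
    apply: eq_card => -[u v1]; apply/AP/imsetP => /= [[[u0 v0 uv] [fu gu fv gv]]|[[w1 w2] + [-> ->]]].
      have := memvf u; rewrite VE.
      move=> /memv_addP[_ /memv_addP[w1 w1V' [_ /vlineP[b1 ->] ->]] [_ /vlineP[c1 ->] uE]].
      have := memvf v1; rewrite VE.
      move=> /memv_addP[_ /memv_addP[w2 w2V' [_ /vlineP[b2 ->] ->]] [_ /vlineP[c2 ->] vE]].
      move: u0 v0 uv fu gu fv gv; rewrite uE vE !Bf // !gE BE // !(eta_split etaQ ef eV' fV') //.
      move=> + + + b1E g1 b2E g2; rewrite b1E b2E mul0r mulr0 !mul1r !addr0 => u0 v0 uv.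
      exists (w1, w2).
        by rewrite !inE /= w2V' v0 g2 !eqxx !andbT -KE memv_cap w1V' mem_kerf ?g1 /=.
      by rewrite /h /= (addr0_eq u0) (addr0_eq uv).
    rewrite !inE /= => /andP[w1K /and3P[w2V' /eqP w20 /eqP gw2]]; have w1V' := KP _ w1K.
    rewrite !Bf // !gE BE // !(eta_split etaQ ef eV' fV') // gK // w20 gw2; split; split=> //; ring.
  rewrite !inE /= => /andP[/KP w1V' /andP[w2V' _]] /andP[/KP z1V' /andP[z2V' _]] [E1 E2].
  have := congr1 (B e) E1; have := congr1 (B e) E2; rewrite !Be // => F2 F1.
  by move: E1 E2; rewrite F1 F2 => /addIr/addIr-> /addIr/addIr->.
by rewrite mulnCA ME expnD; lia.
Qed.
End Lines.

(** * The code *)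

Lemma card_increasing_pairs d :
  (2 * #|{: {p : 'I_d * 'I_d | (p.1 < p.2)%N} }| + d = d * d)%N.
Proof.
rewrite card_sig; set A := #|_|.
have -> : A = #|[set p : 'I_d * 'I_d | (p.1 < p.2)%N]|.
  by apply: eq_card => p; rewrite !inE.
have E : #|[set p : 'I_d * 'I_d | (p.2 < p.1)%N]| = #|[set p : 'I_d * 'I_d | (p.1 < p.2)%N]|.
  rewrite -(card_imset _ (inv_inj (@swap_pairK 'I_d 'I_d))).
  apply: eq_card => -[i j]; rewrite !inE; apply/imsetP/idP => [[[k l] + [-> ->]]|ij].
    by rewrite inE.
  by exists (j, i); rewrite ?inE.
have D : #|[set p : 'I_d * 'I_d | p.1 == p.2]| = d.
  have diag_inj : injective (fun i : 'I_d => (i, i)) by move=> i j [].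
  rewrite -[RHS]card_ord -cardsT -(card_imset _ diag_inj).
  apply: eq_card => -[i j]; rewrite !inE; apply/eqP/imsetP => [/= ->|[k _ [-> ->]] //].
  by exists j.
have := cardsC [set p : 'I_d * 'I_d | (p.1 < p.2)%N]; rewrite card_prod card_ord => <-.
have -> : ~: [set p : 'I_d * 'I_d | (p.1 < p.2)%N] =
    [set p : 'I_d * 'I_d | (p.2 < p.1)%N] :|: [set p : 'I_d * 'I_d | p.1 == p.2].
  by apply/setP => -[i j]; rewrite !inE /= -(inj_eq val_inj) /=; case: ltngtP.
rewrite cardsU E D (_ : _ :&: _ = set0) ?cards0; last first.
  by apply/setP => -[i j]; rewrite !inE /= -(inj_eq val_inj) /=; case: ltngtP.
by lia.
Qed.

Lemma dim_forms (F : finFieldType) (V : vectType F) d : \dim {:V} = d ->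
  (2 * \dim {:'Hom(ext2 V, F^o)} + d = d * d)%N.
Proof.
move=> <-; rewrite dimvf.
rewrite (_ : dim 'Hom(ext2 V, F^o) = #|ext2_index V|) ?card_increasing_pairs //.
by rewrite -[LHS]/(#|ext2_index V| * 1 * 1)%N !muln1.
Qed.
Lemma odd_card (F : finFieldType) : odd #|F| = ((2%:R : F) != 0).
Proof.
have [p pr_p pcharF] := finPcharP F.
have oF : #|F| = (p ^ logn p #|F|)%N := card_pprimeChar pcharF.
have k0 : logn p #|F| != 0%N by apply: contraTneq (finNzRing_gt1 F) => k0; rewrite oF k0.
rewrite oF oddX (negPf k0) /= -(dvdn_pcharf pcharF) dvdn_prime2 //.
have [p2|p2] := even_prime pr_p; first by rewrite p2.
by rewrite p2; case: eqP p2 => // ->.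
Qed.

(** * Functionals on the exterior square as alternating forms; injectivity of the embedding *)

Section PlueckerForms.
Variables (F : finFieldType) (V0 : vectType F).
Local Notation V := (finvect_type V0).
Implicit Types (U W : {vspace V}) (u v : V) (phi : 'Hom(ext2 V, F^o)).

Definition wedge_form phi u v : F := phi (wedge u v).

Lemma wedge_form_bilin phi : bilin (wedge_form phi).
Proof.
split=> u a v w; rewrite /wedge_form.
  by rewrite wedgeDr wedgeZr linearP.
by rewrite wedgeDl wedgeZl linearP.
Qed.

Lemma wedge_form_alternating phi v : wedge_form phi v v = 0.
Proof. by rewrite /wedge_form wedgevv linear0. Qed.

Lemma exists_wedge_form (beta : V -> V -> F) : bilin beta -> (forall v, beta v v = 0) ->
  exists phi, forall u v, wedge_form phi u v = beta u v.
Proof.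
move=> [bl br] b0; have [//|//|//|phi [phiE _]] := @wedge_universal F V F^o beta.
by exists phi.
Qed.

Lemma wedge_form_inj phi psi : (forall u v, wedge_form phi u v = wedge_form psi u v) -> phi = psi.
Proof.
move=> E; have [bl br] := wedge_form_bilin psi.
have [||//|chi [_ chiU]] := @wedge_universal F V F^o (wedge_form psi); [exact: bl|exact: br|exact: wedge_form_alternating|].
by rewrite -(chiU psi) // -(chiU phi).
Qed.

Lemma pluecker_pair_span (p : V * V) : \dim (pair_span p) = 2%N ->
  pluecker (pair_span p) = <[wedge p.1 p.2]>%VS.
Proof. by move=> dU; apply: pluecker_span; rewrite // span_cons span_seq1. Qed.

Lemma exists_basis_pair U : \dim U = 2%N -> exists p, U = pair_span p.
Proof.
move=> dU; have [|u uU u0] := @exists_nonzero _ _ U; first by rewrite dU.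
have [|v vU vu] := @exists_notin _ _ U <[u]>%VS; first by rewrite dU dim_vline u0.
by exists (u, v); apply/esym/eqP; rewrite pair_span_basis //= uU u0 vU.
Qed.

(** If [U] differs from [W], choose [f] vanishing on [W] with [f x = 1] for some [x] in [U], and a
    nonzero [y] in [U] with [f y = 0]. With [g y = 1], the form [f u g v - f v g u] is zero on [W]
    and takes the value 1 on [(x, y)]. *)
Lemma pluecker_inj U W : \dim U = 2%N -> \dim W = 2%N -> pluecker U = pluecker W -> U = W.
Proof.
move=> dU dW E; apply/eqP; rewrite eqEdim dU dW leqnn andbT.
apply/negPn/negP => /subvPn[x xU xW].
have [f [fL fx fW]] := exists_functional xW.
have fxn0 : f x != 0 by rewrite fx oner_neq0.
have [|y] := @exists_nonzero _ _ (U :&: kerf f)%VS.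
  by have := dim_kerf fL xU fxn0; rewrite dU; lia.
rewrite memv_cap mem_kerf // => /andP[yU /eqP fy] y0.
have [g [gL gy _]] : exists g : V -> F, [/\ scalar g, g y = 1 & forall w, w \in 0%VS -> g w = 0].
  by apply: exists_functional; rewrite memv0.
pose beta u v := f u * g v - f v * g u.
have betaL : bilin beta.
  by split=> u a v w; rewrite /beta fL gL; ring.
have [phi phiE] := exists_wedge_form betaL (fun u => subrr _).
have UE : pair_span (x, y) = U.
  apply/eqP; rewrite pair_span_basis //= xU yU /=; apply/andP; split.
    by apply: contraNneq fxn0 => ->; rewrite lin0.
  apply: contra y0 => /vlineP[a yE]; move: fy; rewrite yE linZ // fx mulr1 => ->.
  by rewrite scale0r.
have [[w1 w2] WE] := exists_basis_pair dW.
have [w1W w2W] := mem_pair_span (w1, w2); rewrite -WE /= in w1W w2W.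
have : wedge x y \in pluecker W.
  by rewrite -E -UE pluecker_pair_span ?UE // memv_line.
rewrite WE pluecker_pair_span -?WE // => /vlineP[a /(congr1 phi)].
rewrite linearZ /= -/(wedge_form phi x y) -/(wedge_form phi w1 w2) !phiE /beta.
rewrite fx fy gy (fW w1) // (fW w2) // !mul0r !mul1r !subr0 scaler0 => /eqP.
by rewrite oner_eq0.
Qed.
End PlueckerForms.

(** * Weights of words as numbers of lines, and the kernel of the encoding *)

Section Code.
Variables (F : finFieldType) (V0 : vectType F).
Local Notation V := (finvect_type V0).
Local Notation q := #|F|.
Variable eta : V -> F.
Hypothesis etaQ : is_quadratic_form eta.
Local Notation B := (polar eta).
Variables (N : nat) (omega : 'I_N -> ext2 V).
Hypothesis omegaP : point_representatives eta omega.
Implicit Types (phi psi : 'Hom(ext2 V, F^o)).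

Lemma card_weight (L : {set {vspace V}}) (P : pred 'I_N) :
    L \subset singular_lines eta ->
    (forall i U, U \in singular_lines eta -> <[omega i]>%VS = pluecker U -> P i = (U \in L)) ->
  #|[set i | P i]| = #|L|.
Proof.
have [inj_om im_om _] := omegaP.
move=> Lsing PL; rewrite -(card_imset [set i | P i] inj_om).
have inj_pl : {in L &, injective (@pluecker F V)}.
  move=> U W /(subsetP Lsing)/singular_lineP[dU _] /(subsetP Lsing)/singular_lineP[dW _].
  exact: pluecker_inj.
rewrite -(card_in_imset inj_pl); apply: eq_card => X; apply/imsetP/imsetP => [[i + ->]|[U UL ->]].
  rewrite inE => Pi; have : <[omega i]>%VS \in pluecker_points eta.
    by rewrite -im_om; apply/imsetP; exists i.
  by case/imsetP => U Us UE; exists U => //; rewrite -(PL i U).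
have Us := subsetP Lsing U UL.
have : pluecker U \in [set <[omega i]>%VS | i : 'I_N].
  by rewrite im_om; apply/imsetP; exists U.
by case/imsetP => i _ iE; exists i => //; rewrite inE (PL i U).
Qed.

Lemma length_lines : N = #|singular_lines eta|.
Proof.
rewrite -[LHS]card_ord -cardsT -(@card_weight _ predT) // => [|i U ->] //.
Qed.

Lemma weight_lines phi :
  #|[set i | phi (omega i) != 0]| = #|nonisotropic_lines eta (wedge_form phi)|.
Proof.
apply: card_weight => [|i U Us iU]; first by apply/subsetP => U /nonisotropicP[].
have [dU _] := singular_lineP _ _ Us.
apply/idP/nonisotropicP => [wi|[_ [u [v [uU vU uv]]]]].
  split=> //; have [p UE] := exists_basis_pair dU; have [pU1 pU2] := mem_pair_span p.
  rewrite -UE in pU1 pU2; exists p.1, p.2; split=> //.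
  have : omega i \in <[wedge p.1 p.2]>%VS.
    by rewrite -pluecker_pair_span -?UE // -iU memv_line.
  by case/vlineP=> k kE; apply: contraNneq wi => w0; rewrite kE linearZ /= -/(wedge_form phi p.1 p.2) w0 scaler0.
have UE := nonisotropic_span (wedge_form_bilin phi) (wedge_form_alternating phi) Us uU vU uv.
have : wedge u v \in <[omega i]>%VS.
  by rewrite iU -UE pluecker_pair_span ?UE // memv_line.
by case/vlineP=> k kE; apply: contraNneq uv => wi; rewrite /wedge_form kE linearZ /= wi scaler0.
Qed.

Lemma hamming_dist_word phi psi :
  hamming_dist (word omega phi) (word omega psi) =
  #|nonisotropic_lines eta (wedge_form (phi - psi))|.
Proof.
rewrite -weight_lines; apply: eq_card => i.
by rewrite !inE !mxE -subr_eq0 add_lfunE opp_lfunE.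
Qed.

Lemma word_eq0 phi : (word omega phi == 0) = (#|nonisotropic_lines eta (wedge_form phi)| == 0%N).
Proof.
rewrite -weight_lines cards_eq0; apply/eqP/eqP => [w0|w0].
  by apply/setP => i; rewrite !inE; have /rowP/(_ i) := w0; rewrite !mxE => ->; rewrite eqxx.
apply/rowP => i; rewrite !mxE; apply/eqP; apply: contraT => wi.
by have /setP/(_ i) := w0; rewrite !inE wi.
Qed.

Hypothesis eta_nd : nondegenerate_quadratic_form eta.
Variable m : nat.
Hypothesis dimV : \dim {:V} = (m + m).+3.
Hypothesis m_gt0 : (0 < m)%N.
Local Notation t := (q ^ m)%N.

(** The bound on [weight_pairs] is divided by the number [(q^2 - 1)(q^2 - q)] of bases of a line. As
    [q^2 - q = q (q - 1)], a factor [q] remains beside the weight. *)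
Lemma polar_or_heavy phi :
  (exists l, forall u v, wedge_form phi u v = l * B u v) \/
  (t * t * t * (t - 1) <= q * #|nonisotropic_lines eta (wedge_form phi)|)%N.
Proof.
have [/existsP[l /forallP h]|/existsPn h] :=
    boolP [exists l : F, forall u : V, forall v : V, wedge_form phi u v == l * B u v].
  by left; exists l => u v; apply/eqP/(forallP (h u)).
right; have beta_polar l : exists u v, wedge_form phi u v != l * B u v.
  have := h l; rewrite negb_forall => /existsP[u]; rewrite negb_forall => /existsP[v uv].
  by exists u, v.
have := weight_pairs_lower_bound etaQ eta_nd dimV m_gt0 (wedge_form_bilin phi) (wedge_form_alternating phi) beta_polar.
rewrite (card_nonisotropic_lines etaQ (wedge_form_bilin phi) (wedge_form_alternating phi)).
have q1 := q_gt1 F; have -> : (q * q - q = q * (q - 1))%N by rewrite mulnBr muln1.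
set X := #|_|; have a0 : (0 < (q - 1) * (q * q - 1))%N by nia.
move=> hb; rewrite -(leq_pmul2l a0); move: hb.
move: (q - 1)%N (q * q - 1)%N => a b; set y := (t * t * t)%N; set z := (t - 1)%N.
have -> : (X * (b * (q * a)) = a * b * (q * X))%N by lia.
by rewrite -[(a * b * y * z)%N]mulnA.
Qed.

Lemma polar_no_nonisotropic (beta : V -> V -> F) l :
  (forall u v, beta u v = l * B u v) -> #|nonisotropic_lines eta beta| = 0%N.
Proof.
move=> h; apply/eqP; rewrite cards_eq0; apply/eqP/setP => U; rewrite [RHS]inE.
apply/negP => /nonisotropicP[/singular_lineP[_ Us] [u [v [uU vU]]]].
by rewrite h (totsing_polar Us) // mulr0 eqxx.
Qed.

Lemma word_kernel phi :
  word omega phi = 0 <-> exists l, forall u v, wedge_form phi u v = l * B u v.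
Proof.
split=> [/eqP|[l h]]; last first.
  by apply/eqP; rewrite word_eq0; apply/eqP/(polar_no_nonisotropic h).
rewrite word_eq0 => /eqP w0; have [//|] := polar_or_heavy phi.
rewrite w0 muln0 leqn0 !muln_eq0 !expn_eq0.
have q1 := q_gt1 F; have : (1 < t)%N by rewrite -(expn0 q) ltn_exp2l.
by have := q_gt0 F; move: t q => T Q; lia.
Qed.

Lemma exists_nonsingular : exists v, eta v != 0.
Proof.
apply/existsP; apply: contraT => /existsPn h.
have [|v vV v0] := @exists_nonzero _ _ {:V}; first by rewrite dimV.
have e0 u : eta u = 0 by apply/eqP/negPn/h.
by case/eqP: v0; apply: eta_nd => // w; rewrite /polar !e0 !subr0.
Qed.

(** In characteristic 2 the polar form is itself alternating and spans the kernel; it is nonzero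
    because a nonzero singular vector exists. In odd characteristic, evaluating [l B] at a
    nonsingular vector twice forces [l = 0]. *)
Lemma dim_word_kernel :
  \dim (lker (linfun (word omega))) = ((2%:R : F) == 0).
Proof.
have [F2|F2] := eqVneq (2%:R : F) 0.
  have Balt v : B v v = 0 by rewrite polarvv // -mulr_natl F2 mul0r.
  have [psi psiE] := exists_wedge_form (polar_bilin etaQ) Balt.
  have -> : lker (linfun (word omega)) = <[psi]>%VS.
    apply/vspaceP => phi; rewrite memv_ker lfunE.
    apply/eqP/vlineP => [/word_kernel[l lE]|[l ->]].
      exists l; apply: wedge_form_inj => u v; rewrite lE -psiE /wedge_form.
      by rewrite scale_lfunE.
    by apply/word_kernel; exists l => u v; rewrite /wedge_form scale_lfunE -psiE.
  rewrite dim_vline; apply/eqP; rewrite eqb1; apply/eqP => psi0.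
  have B0 u v : B u v = 0 by rewrite -psiE psi0 /wedge_form zero_lfunE.
  have [|v [_ v0 ev]] := three_dim_isotropic etaQ (U := {:V}); first by rewrite dimV.
  by case/eqP: v0; apply: eta_nd.
apply/eqP; rewrite dimv_eq0 -subv0; apply/subvP => phi; rewrite memv_ker lfunE memv0.
move=> /eqP/word_kernel[l lE]; have [v ev] := exists_nonsingular.
have l0 : l = 0.
  have /eqP := lE v v; rewrite wedge_form_alternating polarvv // eq_sym mulf_eq0 => /orP[/eqP //|].
  by rewrite -mulr_natl mulf_eq0 (negPf F2) (negPf ev).
by apply/eqP/wedge_form_inj => u v'; rewrite lE l0 mul0r /wedge_form zero_lfunE.
Qed.
End Code.

(** * Length, dimension and minimum distance *)

Section CodeParameters.
Variables (F : finFieldType) (V0 : vectType F).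
Local Notation V := (finvect_type V0).
Local Notation q := #|F|.
Variable eta : V -> F.
Hypothesis etaQ : is_quadratic_form eta.
Hypothesis eta_nd : nondegenerate_quadratic_form eta.
Variables (N : nat) (omega : 'I_N -> ext2 V).
Hypothesis omegaP : point_representatives eta omega.
Variable m : nat.
Hypothesis dimV : \dim {:V} = (m + m).+3.
Local Notation t := (q ^ m)%N.

Lemma code_length :
  N%:R = ((q%:R ^+ (m + m).+2 - 1) * (q%:R ^+ (m + m) - 1))
           / ((q%:R - 1) * (q%:R ^+ 2 - 1)) :> rat.
Proof.
have q1 := q_gt1 F; have q0 := q_gt0 F.
have := card_singular_lines etaQ eta_nd dimV; rewrite -(length_lines omegaP).
move=> /(congr1 (fun n : nat => n%:R : rat)).
have h1 : (q <= q ^ (m + m).+1)%N by rewrite expnS leq_pmulr ?expn_gt0 ?q0.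
have h2 : (q <= q * q)%N by rewrite leq_pmulr.
have h3 : (0 < q ^ (m + m).+2)%N by rewrite expn_gt0 q0.
have h4 : (0 < q * q)%N by rewrite muln_gt0 q0.
rewrite !natrM !natrB //.
rewrite !natrM !natrX [_ ^+ (m + m).+1]exprS expr2.
have Q1 : (q%:R : rat) - 1 != 0 by rewrite subr_eq0 Num.Theory.pnatr_eq1 gtn_eqF.
have Q0 : (q%:R : rat) != 0 by rewrite Num.Theory.pnatr_eq0 -lt0n.
have Q2 : (q%:R : rat) * q%:R - 1 != 0.
  by rewrite -natrM subr_eq0 Num.Theory.pnatr_eq1 gtn_eqF // (ltn_trans q1) // ltn_Pmulr.
move: (q%:R : rat) Q0 Q1 Q2 => Q Q0 Q1 Q2 E.
apply: (mulIf (mulf_neq0 Q1 Q2)); rewrite divfK ?mulf_neq0 //.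
apply: (mulIf Q0); transitivity (N%:R * ((Q * Q - 1) * (Q * Q - Q))); first by move: (N%:R : rat) => x; ring.
by rewrite E !exprS; move: (Q ^+ _) => x; ring.
Qed.

Hypothesis m_gt0 : (0 < m)%N.

Lemma code_dim :
  \dim (grassmann_code omega) =
  (if odd q then (m + m).+3 * m.+1 else (m + m).+3 * m.+1 - 1)%N.
Proof.
have dH : \dim {:'Hom(ext2 V, F^o)} = ((m + m).+3 * m.+1)%N.
  by have := dim_forms dimV; move: (\dim _) => D; lia.
have := limg_ker_dim (linfun (word omega)) {:'Hom(ext2 V, F^o)}.
rewrite capfv (dim_word_kernel etaQ omegaP eta_nd dimV m_gt0) odd_card.
by rewrite dH -/(grassmann_code omega) => <-; case: eqP => _ /=; rewrite ?addKn.
Qed.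

(** The extremal form compared with the zero word attains [d]. For distinct words the difference of
    the functionals is not a multiple of the polar form, so [polar_or_heavy] bounds the distance
    below. *)
Lemma code_min_dist d : (q * d = t * t * t * (t - 1))%N ->
  is_min_dist (grassmann_code omega) d.
Proof.
move=> dE; have q0 := q_gt0 F; split=> [|x y /grassmann_codeP[phi ->] /grassmann_codeP[psi ->] xy].
  have [beta [betaL beta0 bE]] := exists_extremal_form etaQ eta_nd dimV.
  have [phi phiE] := exists_wedge_form betaL beta0.
  have wE : #|nonisotropic_lines eta (wedge_form phi)| = d.
    apply/eqP; rewrite -(eqn_pmul2l q0) dE -bE; apply/eqP; congr (_ * _)%N.
    apply: eq_card => U; apply/nonisotropicP/nonisotropicP => -[Us [u [v uv]]];
      by split=> //; exists u, v; rewrite phiE in uv *.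
  exists (word omega phi), (word omega 0); split.
  - by apply/grassmann_codeP; exists phi.
  - by apply/grassmann_codeP; exists 0.
  - rewrite linear0 (word_eq0 omegaP) wE.
    apply/eqP => d0; move/eqP: dE; rewrite d0 muln0 eq_sym !muln_eq0.
    have t1 : (1 < t)%N by rewrite -(expn0 q) ltn_exp2l ?q_gt1.
    by rewrite subn_eq0 leqNgt t1 orbF; move: t1; case: (t).
  by rewrite (hamming_dist_word omegaP) subr0.
rewrite (hamming_dist_word omegaP) -(leq_pmul2l q0) dE.
have [h|//] := polar_or_heavy etaQ eta_nd dimV m_gt0 (phi - psi).
have /rowP w0 := (word_kernel etaQ omegaP eta_nd dimV m_gt0 (phi - psi)).2 h.
case/eqP: xy; apply/rowP => i; apply/subr0_eq.
by have := w0 i; rewrite !mxE add_lfunE opp_lfunE.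
Qed.
End CodeParameters.

Theorem corollary1p1
    (F : finFieldType) (q : nat) (n : nat) (V : vectType F) (eta : V -> F)
    (N : nat) (omega : 'I_N -> ext2 V) :
  #|F| = q ->
  (2 <= n)%N ->
  \dim {:V} = (2 * n + 1)%N ->
  is_quadratic_form eta ->
  nondegenerate_quadratic_form eta ->
  point_representatives eta omega ->
  [/\ N%:R = ((q%:R ^+ (2 * n) - 1) * (q%:R ^+ (2 * n - 2) - 1))
               / ((q%:R - 1) * (q%:R ^+ 2 - 1)) :> rat,
      \dim (grassmann_code omega) =
        (if odd q then (2 * n + 1) * n else (2 * n + 1) * n - 1)%N
    & is_min_dist (grassmann_code omega) (q ^ (4 * n - 5) - q ^ (3 * n - 4))%N].
Proof.
(* Once the class of [V] is destructed, [V] and [finvect_type V] are convertible. *)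
case: V eta omega => T [c1 c2 c3 c4 c5 c6 c7 c8 c9 c10 c11].
set V := Vector.Pack _ => eta omega <-; case: n => [|m] //; rewrite ltnS => m_gt0.
have [-> -> ->] : [/\ (2 * m.+1 + 1 = (m + m).+3), (2 * m.+1 = (m + m).+2)
  & ((m + m).+2 - 2 = m + m)]%N by split; lia.
move=> dimV etaQ eta_nd omegaP; split.
- exact: (@code_length F V eta etaQ eta_nd N omega omegaP m dimV).
- exact: (@code_dim F V eta etaQ eta_nd N omega omegaP m dimV m_gt0).
apply: (@code_min_dist F V eta etaQ eta_nd N omega omegaP m dimV m_gt0).
(* With [n = m + 1] the exponents are [4m - 1] and [3m - 1]; since [m > 0] the subtractions do not
   truncate, and both sides equal [q^(4m) - q^(3m)]. *)
rewrite mulnBr mulnBr muln1 -!expnS -!expnD; congr (_ ^ _ - _ ^ _)%N; lia.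
Qed.
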